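(* Let $g \geq 2$ and $k \geq 2$. Then the map $\operatorname{Tr}^A_k : \mathcal{G}_k \to S^k(H')$ vanishes on $\tau_k(\mathcal{A}_k) \subset \mathcal{G}_k$; that is, $\operatorname{Tr}^A_k(\tau_k(\varphi)) = 0$ for every $\varphi \in \mathcal{A}_k$.
   Context: Let $\Sigma = \Sigma_{g,1}$ be a compact connected oriented surface of genus $g$ with one boundary component, and let $\mathcal{M}$ be its mapping class group (relative to the boundary). Let $V_g$ be a genus $g$ handlebody whose boundary minus a disk is identified with $\Sigma$. The handlebody group $\mathcal{A} \subset \mathcal{M}$ is the subgroup of mapping classes that extend to $V_g$. Put $\pi = \pi_1(\Sigma)$ (base point on $\partial\Sigma$; free of rank $2g$), $\pi' = \pi_1(V_g)$ (free of rank $g$), $H = H_1(\Sigma;\mathbb{Z})$, $H' = H_1(V_g;\mathbb{Z})$. Let $\mathbb{A} = \ker(\pi \to \pi')$ and $A = \ker(H \to H')$, the maps being induced by $\Sigma \subset V_g$. The group $\mathcal{A}$ coincides with the subgroup of $\mathcal{M}$ preserving $\mathbb{A}$. The intersection form of $\Sigma$ is a symplectic form $\omega : H \otimes H \to \mathbb{Z}$, and $H$ is identified with $H^* = \operatorname{Hom}(H,\mathbb{Z})$ via $x \mapsto \omega(x,-)$. The subgroup $A$ is Lagrangian and $\omega$ induces a perfect pairing $\omega' : A \otimes H' \to \mathbb{Z}$, which identifies $A$ with $(H')^*$. For an abelian group $M$, let $T(M) = \bigoplus_k T_k(M)$ be the tensor algebra, $\mathcal{L}(M) = \bigoplus_k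 \mathcal{L}_k(M)$ the free graded Lie ring on $M$ (embedded in $T(M)$ by $[a,b] = a\otimes b - b\otimes a$), and $S^k(M)$ the $k$-th symmetric power. Let $\Gamma_1\pi = \pi$, $\Gamma_{k+1}\pi = [\pi, \Gamma_k\pi]$ be the lower central series; $\Gamma_k\pi/\Gamma_{k+1}\pi \simeq \mathcal{L}_k(H)$. Johnson filtration and homomorphisms: for $k\ge 1$, $J_k \subset \mathcal{M}$ is the subgroup of elements acting trivially on $\pi/\Gamma_{k+1}\pi$, and $\mathcal{A}_k = \mathcal{A} \cap J_k$. The $k$-th Johnson homomorphism $\tau_k : J_k \to \operatorname{Hom}(H, \mathcal{L}_{k+1}(H)) \simeq H^*\otimes\mathcal{L}_{k+1}(H) \simeq H \otimes \mathcal{L}_{k+1}(H)$ sends $\varphi$ to the map $\{x\} \mapsto \{\varphi(x)x^{-1}\} \in \Gamma_{k+1}\pi/\Gamma_{k+2}\pi$. It takes values in $D_k(H) = \ker\big([\,,\,] : H \otimes \mathcal{L}_{k+1}(H) \to \mathcal{L}_{k+2}(H)\big)$. Similarly let $D_k(H') = \ker\big(H' \otimes \mathcal{L}_{k+1}(H') \to \mathcal{L}_{k+2}(H')\big)$. Let $\mathcal{G}_k$ be the kernel of the natural projection $D_k(H) \to D_k(H')$ induced by $H \to H'$. It is known that $\tau_k(\mathcal{A}_k) \subset \mathcal{G}_k$. Lagrangian trace: for $k\ge 1$, the image of an element of $\mathcal{G}_k$ in $H \otimes \mathcal{L}_{k+1}(H')$ lies in $A \otimes \mathcal{L}_{k+1}(H')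 = \ker\big(H\otimes\mathcal{L}_{k+1}(H') \to H'\otimes\mathcal{L}_{k+1}(H')\big)$. The map $\operatorname{Tr}^A_k : \mathcal{G}_k \to S^k(H')$ is the composition $$\mathcal{G}_k \to A \otimes \mathcal{L}_{k+1}(H') \hookrightarrow A \otimes T_{k+1}(H') \xrightarrow{(\omega')^{1,2}} T_k(H') \twoheadrightarrow S^k(H'),$$ where $(\omega')^{1,2}$ contracts the first two tensor factors by $\omega'$, i.e. $a \otimes h_1 \otimes \cdots \otimes h_{k+1} \mapsto \omega'(a,h_1)\, h_2 \otimes \cdots \otimes h_{k+1}$. *)

(* Defs.v *)
From HB Require Import structures.
From mathcomp Require Import all_boot all_order all_algebra.
From mathcomp Require Import generic_quotient.
From mathcomp Require Import all_classical all_reals topology normedtype.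
From mathcomp Require Import ring lra.
From mathcomp Require Import -(notations) mpoly monalg.

Set Implicit Arguments.
Unset Strict Implicit.
Unset Printing Implicit Defensive.

Import Order.TTheory GRing.Theory Num.Theory numFieldNormedType.Exports.
Local Open Scope classical_set_scope.
Local Open Scope quotient_scope.
Local Open Scope ring_scope.

(* A loop [0,1] -> T based at [x0] is encoded by its extension to the whole
   line by the constant [x0]; this is a bijection onto ordinary loops. *)
Record loop (R : realType) (T : topologicalType) (x0 : T) := Loop {
  loop_fun :> R -> T;
  loop_cont : continuous loop_fun;
  loop_out : forall t, (t <= 0) || (1 <= t) -> loop_fun t = x0 }.

HB.instance Definition _ R T x0 := gen_eqMixin (@loop R T x0).
HB.instance Definition _ R T x0 := gen_choiceMixin (@loop R T x0).

Lemma loopP (R : realType) (T : topologicalType) (x0 : T) (p q : loop R x0) :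
  p =1 q -> p = q.
Proof.
case: p q => [p cp op] [q cq oq] /= /funext E; case: _ / E in cq oq *.
by congr Loop; exact: Prop_irrelevance.
Qed.

Definition homotopic (R : realType) (T : topologicalType) (x0 : T)
    (p q : loop R x0) : Prop :=
  exists h : R * R -> T,
    [/\ continuous h,
        forall t, h (0, t) = p t,
        forall t, h (1, t) = q t &
        forall s t, 0 <= s <= 1 -> (t <= 0) || (1 <= t) -> h (s, t) = x0].

Section FundamentalGroup.
Context (R : realType).

Lemma paste (U T : topologicalType) (c : U -> R) (a : R) (f g : U -> T) :
  continuous c -> continuous f -> continuous g ->
  (forall u, c u = a -> f u = g u) ->
  continuous (fun u => if c u <= a then f u else g u).
Proof.
move=> cc cf cg fg.
pose A := [set u | c u <= a]; pose B := [set u | a <= c u].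
have clA : closed A by apply: (closed_comp _ (@closed_le _ a)) => x _; exact: cc.
have clB : closed B by apply: (closed_comp _ (@closed_ge _ a)) => x _; exact: cc.
have AB : A `|` B = setT.
  by apply/seteqP; split=> // u _ /=; rewrite /A /B /=; case: (leP (c u) a) => h;
     [left|right; exact: ltW].
apply/continuous_subspace_setT; rewrite -AB; apply: withinU_continuous => //.
  apply: (@subspace_eq_continuous _ _ _ f); last exact: continuous_subspaceT.
  by move=> x; rewrite inE /A /from_subspace /= => ->.
apply: (@subspace_eq_continuous _ _ _ g); last exact: continuous_subspaceT.
move=> x; rewrite inE /B /from_subspace /= => h.
case: ifPn => // h'; symmetry; apply: fg; apply/eqP; rewrite eq_le; exact/andP.
Qed.


Lemma affine_cont (a b : R) : continuous (fun t : R => a * t + b).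
Proof.
by move=> t; apply: cvgD; [apply: cvgM; [exact: cvg_cst|]|exact: cvg_cst].
Qed.

Lemma comp_cont (U V W : topologicalType) (f : U -> V) (g : V -> W) :
  continuous f -> continuous g -> continuous (g \o f).
Proof. by move=> cf cg u; apply: continuous_comp; [exact: cf|exact: cg]. Qed.

Lemma pair_cont (U V W : topologicalType) (f : U -> V) (g : U -> W) :
  continuous f -> continuous g -> continuous (fun u => (f u, g u)).
Proof.
by move=> cf cg u; apply: (@cvg_pair _ _ _ _ (nbhs (f u)) (nbhs (g u)));
  [exact: cf|exact: cg].
Qed.

Context (T : topologicalType) (x0 : T).
Implicit Types p q r : loop R x0.

Lemma loop_comp_cont (U : topologicalType) (c : U -> R) p :
  continuous c -> continuous (p \o c).
Proof. by move=> cc; apply: comp_cont => //; exact: loop_cont. Qed.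

Lemma loop_one_out (t : R) : (t <= 0) || (1 <= t) -> cst x0 t = x0.
Proof. by []. Qed.

Definition loop_one : loop R x0 := Loop (@cst_continuous R T x0) loop_one_out.

Definition loop_mul_fun p q (t : R) : T :=
  if t <= 2^-1 then p (2 * t) else q (2 * t - 1).

Lemma loop_mul_cont p q : continuous (loop_mul_fun p q).
Proof.
apply: (@paste R T (fun t : R => t)).
- by move=> t; exact: cvg_id.
- suff : continuous (p \o (fun t : R => 2 * t)) by [].
  by apply: loop_comp_cont => t; apply: cvgM; [exact: cvg_cst|].
- suff : continuous (q \o (fun t : R => 2 * t - 1)) by [].
  exact/loop_comp_cont/affine_cont.
- by move=> u ->; rewrite !loop_out //; lra.
Qed.

Lemma loop_mul_out p q t : (t <= 0) || (1 <= t) -> loop_mul_fun p q t = x0.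
Proof. by rewrite /loop_mul_fun => h; case: ifPn => h'; rewrite loop_out //; lra. Qed.

Definition loop_mul p q : loop R x0 :=
  Loop (@loop_mul_cont p q) (@loop_mul_out p q).

Lemma loop_inv_cont p : continuous (fun t : R => p (1 - t)).
Proof.
suff : continuous (p \o (fun t : R => 1 - t)) by [].
by apply: loop_comp_cont => t; apply: cvgB; [exact: cvg_cst|].
Qed.

Lemma loop_inv_out p t : (t <= 0) || (1 <= t) -> p (1 - t) = x0.
Proof. by move=> h; rewrite loop_out //; lra. Qed.

Definition loop_inv p : loop R x0 :=
  Loop (@loop_inv_cont p) (@loop_inv_out p).

Lemma homotopic_clamp p q : homotopic p q ->
  exists h : R * R -> T,
    [/\ continuous h,
        forall t, h (0, t) = p t,
        forall t, h (1, t) = q t &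
        forall s t, (t <= 0) || (1 <= t) -> h (s, t) = x0].
Proof.
move=> [h [ch h0 h1 ho]].
pose c (s : R) := Num.max 0 (Num.min 1 s).
have cc : continuous c.
  move=> s; apply: continuous_max; first exact: cst_continuous.
  by apply: continuous_min; first exact: cst_continuous.
exists (fun st => h (c st.1, st.2)); split=> /=.
- apply: (@comp_cont _ _ _ (fun st : R * R => (c st.1, st.2)) h) => //.
  apply: pair_cont; last by move=> st; exact: cvg_snd.
  by apply: (@comp_cont _ _ _ fst c) => // st; exact: cvg_fst.
- by move=> t; rewrite /c min_r ?ler01// maxxx h0.
- by move=> t; rewrite /c minxx max_r ?ler01// h1.
- move=> s t; apply: ho; rewrite /c le_max lexx /= ge_max ler01 /=.
  by rewrite ge_min lexx.
Qed.

Lemma homotopic_refl p : homotopic p p.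
Proof.
exists (fun st => p st.2); split=> //; last by move=> s t _; exact: loop_out.
suff : continuous (p \o (snd : R * R -> R)) by [].
by apply: loop_comp_cont => st; exact: cvg_snd.
Qed.

Let cfst : continuous (fst : R * R -> R). Proof. by move=> st; exact: cvg_fst. Qed.
Let csnd : continuous (snd : R * R -> R). Proof. by move=> st; exact: cvg_snd. Qed.
Let caff (a b : R) (c : R * R -> R) :
  continuous c -> continuous (fun st => a * c st + b).
Proof. by move=> cc; exact: (comp_cont cc (@affine_cont a b)). Qed.
Let cscal (a : R) (c : R * R -> R) :
  continuous c -> continuous (fun st => a * c st).
Proof. by move=> cc st; apply: cvgM; [exact: cvg_cst|exact: cc]. Qed.
Let cflip (c : R * R -> R) : continuous c -> continuous (fun st => 1 - c st).
Proof. by move=> cc st; apply: cvgB; [exact: cvg_cst|exact: cc]. Qed.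

Lemma homotopic_sym p q : homotopic p q -> homotopic q p.
Proof.
move=> [h [ch h0 h1 ho]]; exists (fun st => h (1 - st.1, st.2)); split=> //=.
- by apply: (comp_cont (pair_cont (cflip cfst) csnd) ch).
- by move=> t; rewrite subr0.
- by move=> t; rewrite subrr.
- by move=> s t s01; apply: ho; lra.
Qed.

Lemma homotopic_trans p q r : homotopic p q -> homotopic q r -> homotopic p r.
Proof.
move=> [h [ch h0 h1 ho]] [k [ck k0 k1 ko]].
exists (fun st => if st.1 <= 2^-1 then h (2 * st.1, st.2)
                  else k (2 * st.1 - 1, st.2)); split=> /=.
- apply: (@paste _ _ fst _ (fun st => h (2 * st.1, st.2))
    (fun st => k (2 * st.1 - 1, st.2))).
  + exact: cfst.
  + exact: (comp_cont (pair_cont (@cscal 2 _ cfst) csnd) ch).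
  + exact: (comp_cont (pair_cont (@caff 2 (-1) _ cfst) csnd) ck).
  + by move=> [s t] /= ->; rewrite mulfV ?pnatr_eq0// subrr h1 k0.
- by move=> t; rewrite ifT ?mulr0 ?h0// invr_ge0.
- move=> t; rewrite ifF; last by apply/negbTE; lra.
  by rewrite (_ : 2 * 1 - 1 = 1) ?k1//; lra.
- by move=> s t s01 o; case: ifPn => h'; [apply: ho|apply: ko] => //; lra.
Qed.

Lemma homotopic_mul p p' q q' :
  homotopic p p' -> homotopic q q' -> homotopic (loop_mul p q) (loop_mul p' q').
Proof.
move=> /homotopic_clamp[h [ch h0 h1 ho]] /homotopic_clamp[k [ck k0 k1 ko]].
exists (fun st => if st.2 <= 2^-1 then h (st.1, 2 * st.2)
                  else k (st.1, 2 * st.2 - 1)); split=> /=.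
- apply: (@paste _ _ snd _ (fun st => h (st.1, 2 * st.2))
    (fun st => k (st.1, 2 * st.2 - 1))).
  + exact: csnd.
  + exact: (comp_cont (pair_cont cfst (@cscal 2 _ csnd)) ch).
  + exact: (comp_cont (pair_cont cfst (@caff 2 (-1) _ csnd)) ck).
  + by move=> [s t] /= ->; rewrite ho ?ko //; lra.
- by move=> t; rewrite /loop_mul_fun h0 k0.
- by move=> t; rewrite /loop_mul_fun h1 k1.
- by move=> s t _ o; case: ifPn => h'; [apply: ho|apply: ko] => //; lra.
Qed.

Lemma homotopic_inv p p' : homotopic p p' -> homotopic (loop_inv p) (loop_inv p').
Proof.
move=> [h [ch h0 h1 ho]]; exists (fun st => h (st.1, 1 - st.2)); split=> //=.
- by apply: (comp_cont (pair_cont cfst (cflip csnd)) ch).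
- by move=> s t s01 o; apply: ho => //; lra.
Qed.

Lemma homotopic_reparam p q r (f g : R -> R) :
  continuous f -> continuous g ->
  (forall t, (t <= 0) || (1 <= t) ->
     (f t <= 0) && (g t <= 0) || (1 <= f t) && (1 <= g t)) ->
  (forall t, q t = p (f t)) -> (forall t, r t = p (g t)) -> homotopic q r.
Proof.
move=> cf cg out qE rE.
exists (fun st => p ((1 - st.1) * f st.2 + st.1 * g st.2)); split=> /=.
- suff : continuous (p \o (fun st : R * R => (1 - st.1) * f st.2 + st.1 * g st.2)) by [].
  apply: loop_comp_cont.
  have cf2 : continuous (f \o snd : R * R -> R) by exact: comp_cont.
  have cg2 : continuous (g \o snd : R * R -> R) by exact: comp_cont.
  move=> st; apply: cvgD; apply: cvgM.
  + exact: (cflip cfst).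
  + exact: cf2.
  + exact: cfst.
  + exact: cg2.
- by move=> t; rewrite subr0 mul1r mul0r addr0 qE.
- by move=> t; rewrite subrr mul0r add0r mul1r rE.
- move=> s t /andP[s0 s1] /out /orP[] /andP[ft gt]; rewrite loop_out //.
  + by apply/orP; left; nra.
  + by apply/orP; right; nra.
Qed.

Definition homotopicb p q : bool := `[< homotopic p q >].

Lemma homotopicb_refl : reflexive homotopicb.
Proof. by move=> p; apply/asboolP; exact: homotopic_refl. Qed.

Lemma homotopicb_sym : ssrbool.symmetric homotopicb.
Proof. by move=> p q; apply/asboolP/asboolP; exact: homotopic_sym. Qed.

Lemma homotopicb_trans : transitive homotopicb.
Proof.
move=> q p r /asboolP pq /asboolP qr; apply/asboolP; exact: homotopic_trans pq qr.
Qed.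

Canonical homotopicb_equiv :=
  EquivRel homotopicb homotopicb_refl homotopicb_sym homotopicb_trans.

Definition pi1 := {eq_quot homotopicb}.
HB.instance Definition _ := Choice.on pi1.
HB.instance Definition _ := EqQuotient.on pi1.

Definition pi1_class p : pi1 := \pi_pi1 p.

Lemma pi1_classP p q : pi1_class p = pi1_class q <-> homotopic p q.
Proof. by split=> [/eqmodP/asboolP//|h]; apply/eqmodP/asboolP. Qed.

Lemma pi1_ind (P : pi1 -> Prop) : (forall p, P (pi1_class p)) -> forall x, P x.
Proof. by move=> h x; rewrite -[x]reprK; exact: h. Qed.

Lemma pi1_repr p : homotopic (repr (pi1_class p)) p.
Proof. by apply/pi1_classP; rewrite /pi1_class reprK. Qed.

Definition pi1_one : pi1 := pi1_class loop_one.
Definition pi1_mul (x y : pi1) : pi1 := pi1_class (loop_mul (repr x) (repr y)).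
Definition pi1_inv (x : pi1) : pi1 := pi1_class (loop_inv (repr x)).

Lemma pi1_mulE p q :
  pi1_mul (pi1_class p) (pi1_class q) = pi1_class (loop_mul p q).
Proof. by apply/pi1_classP/homotopic_mul; exact: pi1_repr. Qed.

Lemma pi1_invE p : pi1_inv (pi1_class p) = pi1_class (loop_inv p).
Proof. by apply/pi1_classP/homotopic_inv; exact: pi1_repr. Qed.

Lemma pi1_mulA : associative pi1_mul.
Proof.
elim/pi1_ind => p; elim/pi1_ind => q; elim/pi1_ind => r.
rewrite !pi1_mulE; apply/pi1_classP.
apply: (@homotopic_reparam (loop_mul (loop_mul p q) r) _ _
  (fun t => Num.max (2^-1 * t) (Num.max (t - 4^-1) (2 * t - 1))) id).
- move=> t; apply: continuous_max; [|apply: continuous_max].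
  + by apply: cvgM; [exact: cvg_cst|].
  + by apply: cvgB; [|exact: cvg_cst].
  + exact: affine_cont.
- by move=> t; exact: cvg_id.
- move=> t; rewrite !ge_max !le_max => h; lra.
- move=> t /=; rewrite /loop_mul_fun /= /loop_mul_fun.
  have [t1|t1] := leP t 2^-1.
    rewrite (_ : Num.max _ _ = 2^-1 * t); last by rewrite max_l // ge_max; lra.
    rewrite (_ : (2^-1 * t <= 2^-1) = true); last by lra.
    rewrite (_ : (2 * (2^-1 * t) <= 2^-1) = true); last by lra.
    by congr (p _); lra.
  have [t2|t2] := leP (2 * t - 1) 2^-1.
    rewrite (_ : Num.max (2^-1 * t) (Num.max (t - 4^-1) (2 * t - 1)) = t - 4^-1); last first.
      by apply/eqP; rewrite eq_le !ge_max !le_max; lra.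
    rewrite (_ : (t - 4^-1 <= 2^-1) = true); last by lra.
    rewrite (_ : (2 * (t - 4^-1) <= 2^-1) = false); last by apply/negbTE; lra.
    by congr (q _); lra.
  rewrite (_ : Num.max (2^-1 * t) (Num.max (t - 4^-1) (2 * t - 1)) = 2 * t - 1); last first.
    by rewrite [Num.max (t - _) _]max_r; [rewrite max_r //; lra|lra].
  by rewrite (_ : (2 * t - 1 <= 2^-1) = false)//; apply/negbTE; lra.
- by [].
Qed.

Lemma pi1_mul1 : left_id pi1_one pi1_mul.
Proof.
elim/pi1_ind => p; rewrite pi1_mulE; apply/pi1_classP.
apply: (@homotopic_reparam p _ _ (fun t => 2 * t - 1) id) => //.
- exact: affine_cont.
- by move=> t; exact: cvg_id.
- by move=> t h; lra.
- by move=> t /=; rewrite /loop_mul_fun /=; case: ifPn => // h; rewrite loop_out //; lra.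
Qed.

Lemma pi1_mulr1 : right_id pi1_one pi1_mul.
Proof.
elim/pi1_ind => p; rewrite pi1_mulE; apply/pi1_classP.
apply: (@homotopic_reparam p _ _ (fun t => 2 * t) id) => //.
- by move=> t; apply: cvgM; [exact: cvg_cst|].
- by move=> t; exact: cvg_id.
- by move=> t h; lra.
- by move=> t /=; rewrite /loop_mul_fun /=; case: ifPn => // h; rewrite loop_out //; lra.
Qed.

Lemma pi1_mulrV : right_inverse pi1_one pi1_inv pi1_mul.
Proof.
elim/pi1_ind => p; rewrite pi1_invE pi1_mulE; apply/pi1_classP.
apply: (@homotopic_reparam p _ _ (fun t => Num.min (2 * t) (2 - 2 * t)) (fun=> 0)).
- move=> t; apply: continuous_min; first by apply: cvgM; [exact: cvg_cst|].
  by apply: cvgB; [exact: cvg_cst|apply: cvgM; [exact: cvg_cst|]].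
- exact: cst_continuous.
- by move=> t; rewrite !ge_min !le_min => h; lra.
- move=> t /=; rewrite /loop_mul_fun /=; case: ifPn => h.
    by rewrite min_l//; lra.
  by rewrite min_r; [congr (p _)|]; lra.
- by move=> t /=; rewrite loop_out ?lexx.
Qed.

Lemma pi1_mulVr : left_inverse pi1_one pi1_inv pi1_mul.
Proof.
elim/pi1_ind => p; rewrite pi1_invE pi1_mulE; apply/pi1_classP.
apply: (@homotopic_reparam p _ _ (fun t => Num.max (1 - 2 * t) (2 * t - 1)) (fun=> 1)).
- move=> t; apply: (@continuous_max R R (fun t => 1 - 2 * t) (fun t => 2 * t - 1));
    last exact: affine_cont.
  by apply: cvgB; [exact: cvg_cst|apply: cvgM; [exact: cvg_cst|]].
- exact: cst_continuous.
- by move=> t; rewrite !ge_max !le_max => h; lra.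
- move=> t /=; rewrite /loop_mul_fun /=; case: ifPn => h.
    by rewrite max_l//; lra.
  by rewrite max_r//; lra.
- by move=> t /=; rewrite loop_out ?lexx ?orbT.
Qed.

HB.instance Definition _ := isGroup.Build pi1
  pi1_mulA pi1_mul1 pi1_mulr1 pi1_mulVr pi1_mulrV.

Lemma pi1_classM p q :
  (pi1_class p * pi1_class q)%g = pi1_class (loop_mul p q).
Proof. exact: pi1_mulE. Qed.

End FundamentalGroup.

Record ptmap (T S : topologicalType) (x0 : T) (y0 : S) := PtMap {
  pm_fun :> T -> S;
  pm_cont : continuous pm_fun;
  pm_base : pm_fun x0 = y0 }.

Section Pushforward.
Context (R : realType) (T S : topologicalType) (x0 : T) (y0 : S).
Variable f : ptmap x0 y0.

Lemma loop_push_cont (p : loop R x0) : continuous (f \o p).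
Proof. by apply: comp_cont; [exact: loop_cont|exact: pm_cont]. Qed.

Lemma loop_push_out (p : loop R x0) (t : R) :
  (t <= 0) || (1 <= t) -> (f \o p) t = y0.
Proof. by move=> h; rewrite /= loop_out// pm_base. Qed.

Definition loop_push (p : loop R x0) : loop R y0 :=
  Loop (@loop_push_cont p) (@loop_push_out p).

Definition pi1_map (x : pi1 R x0) : pi1 R y0 := pi1_class (loop_push (repr x)).

Lemma pi1_mapE p : pi1_map (pi1_class p) = pi1_class (loop_push p).
Proof.
apply/pi1_classP; have [h [ch h0 h1 ho]] := pi1_repr p.
exists (f \o h); split=> /=.
- exact: comp_cont ch (@pm_cont _ _ _ _ f).
- by move=> t; rewrite h0.
- by move=> t; rewrite h1.
- by move=> s t s01 o; rewrite ho// pm_base.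
Qed.

Lemma pi1_mapM : {morph pi1_map : x y / (x * y)%g}.
Proof.
elim/pi1_ind => p; elim/pi1_ind => q.
rewrite pi1_classM !pi1_mapE pi1_classM.
congr pi1_class; apply: loopP => t; rewrite /= /loop_mul_fun /=.
by case: ifP.
Qed.

End Pushforward.

Definition embedding (T S : topologicalType) (f : T -> S) : Prop :=
  injective f /\ forall A : set T, open A <-> exists2 B, open B & A = f @^-1` B.

(* The box [0, 3g] x [0, 3] x [0, 1] with g disjoint round vertical holes of
   radius 1 drilled through it. *)
Definition std_handlebody (R : realType) (g : nat) : set (R * R * R) :=
  [set p | [/\ 0 <= p.1.1 <= 3 * g%:R, 0 <= p.1.2 <= 3, 0 <= p.2 <= 1 &
     forall i : 'I_g,
       1 <= (p.1.1 - (3 * i%:R + 3 / 2)) ^+ 2 + (p.1.2 - 3 / 2) ^+ 2]].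

Record handlebody (R : realType) (g : nat) := Handlebody {
  hb_space :> topologicalType;
  hb_chart : hb_space -> R * R * R;
  hb_chart_emb : embedding hb_chart;
  hb_chart_range : range hb_chart = @std_handlebody R g }.

(* For a codimension 0 submanifold of R^3, manifold boundary = frontier. *)
Definition hb_boundary (R : realType) (g : nat) (V : handlebody R g) : set V :=
  @hb_chart R g V @^-1`
    (closure (@std_handlebody R g) `\` interior (@std_handlebody R g)).

Definition closed_disk (R : realType) : set (R * R) :=
  [set p | p.1 ^+ 2 + p.2 ^+ 2 <= 1].
Definition open_disk (R : realType) : set (R * R) :=
  [set p | p.1 ^+ 2 + p.2 ^+ 2 < 1].
Definition circle (R : realType) : set (R * R) :=
  [set p | p.1 ^+ 2 + p.2 ^+ 2 = 1].

(* [surface V] is a surface Sigma identified, by [sf_incl], with the boundary of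
   the genus g handlebody [V] minus an open disk; thus Sigma is a compact
   connected surface of genus g whose boundary is the rim of the disk.
   An orientation of Sigma amounts to one of this boundary circle: it is given
   by the based loop [sf_rim], which runs once around it. *)
Record surface (R : realType) (g : nat) (V : handlebody R g) := Surface {
  sf_space :> topologicalType;
  sf_incl : sf_space -> V;
  sf_incl_emb : embedding sf_incl;
  sf_disk : R * R -> V;
  sf_disk_cont : {within @closed_disk R, continuous sf_disk};
  sf_disk_inj : {in @closed_disk R &, injective sf_disk};
  sf_disk_boundary : sf_disk @` @closed_disk R `<=` @hb_boundary R g V;
  sf_incl_range :
    range sf_incl = @hb_boundary R g V `\` sf_disk @` @open_disk R;
  sf_base : sf_space;
  sf_rim : loop R sf_base;
  sf_rim_range :
    sf_rim @` [set t | 0 <= t <= 1] = sf_incl @^-1` (sf_disk @` @circle R);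
  sf_rim_inj : {in [set t : R | 0 <= t < 1] &, injective sf_rim} }.

Section MappingClasses.
Context (R : realType) (g : nat) (V : handlebody R g) (S : surface V).

Definition sf_boundary : set S := @sf_incl _ _ _ S @^-1` (sf_disk S @` @circle R).

Lemma sf_base_boundary : sf_boundary (sf_base S).
Proof.
rewrite /sf_boundary -sf_rim_range; exists 0 => /=; first by rewrite lexx ler01.
by rewrite loop_out ?lexx.
Qed.

Lemma sf_incl_cont : continuous (@sf_incl _ _ _ S).
Proof.
by apply/continuousP => B oB; apply/(sf_incl_emb S).2; exists B.
Qed.

Definition sf_ptincl : ptmap (sf_base S) (sf_incl (sf_base S)) :=
  PtMap sf_incl_cont erefl.

(* Orientation-preserving is automatic, the boundary being fixed pointwise. *)
Record homeo_rel := HomeoRel {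
  hr_fun :> S -> S;
  hr_inv : S -> S;
  hr_cont : continuous hr_fun;
  hr_inv_cont : continuous hr_inv;
  hr_funK : cancel hr_fun hr_inv;
  hr_invK : cancel hr_inv hr_fun;
  hr_fix : forall x, sf_boundary x -> hr_fun x = x }.

Definition hr_pt (f : homeo_rel) : ptmap (sf_base S) (sf_base S) :=
  PtMap (@hr_cont f) (hr_fix f sf_base_boundary).

Definition isotopic (f f' : homeo_rel) : Prop :=
  exists h : R * S -> S,
    [/\ continuous h,
        forall x, h (0, x) = f x,
        forall x, h (1, x) = f' x &
        forall s, 0 <= s <= 1 ->
          exists phi : homeo_rel, forall x, h (s, x) = phi x].

Definition extends_to_handlebody (f : homeo_rel) : Prop :=
  exists F G : V -> V,
    [/\ continuous F, continuous G, cancel F G, cancel G F &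
        forall x, F (sf_incl x) = sf_incl (f x)].

(* The isotopy class of [f] belongs to the handlebody group. *)
Definition in_handlebody_group (f : homeo_rel) : Prop :=
  exists2 f', isotopic f f' & extends_to_handlebody f'.

End MappingClasses.

Inductive generated (G : groupType) (A : set G) : G -> Prop :=
| gen_in x : A x -> generated A x
| gen_one : generated A 1%g
| gen_mul x y : generated A x -> generated A y -> generated A (x * y)%g
| gen_inv x : generated A x -> generated A x^-1%g.

Fixpoint lcs_succ (G : groupType) (k : nat) : set G :=
  if k is m.+1 then
    generated [set [~ x, y]%g | x in [set: G] & y in @lcs_succ G m]
  else setT.

(* lcs G k is Gamma_k G, for k >= 1. *)
Definition lcs (G : groupType) (k : nat) : set G := @lcs_succ G k.-1.

Definition free_basis (J : Type) (G : groupType) (b : J -> G) : Prop :=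
  forall (K : groupType) (c : J -> K),
    exists! f : G -> K, {morph f : x y / (x * y)%g} /\ forall j, f (b j) = c j.

(* The tensor algebra of the free abelian group with basis J, i.e. the free
   associative ring on J; T_k is spanned by the words of length k. *)
Definition tens (J : choiceType) : nzRingType := malg (fmonom J) int.

Definition tgen (J : choiceType) (j : J) : tens J := mkmalgU (fmu j) 1.

Definition bracket (A : nzRingType) (u v : A) : A := u * v - v * u.

(* The ring morphism T(Z^J) -> T(Z^K) extending e_j |-> p j. *)
Definition tens_map (J K : choiceType) (p : J -> tens K) : tens J -> tens K :=
  mmap intr (fun w : fmonom J => \prod_(j <- (w : seq J)) p j).

(* free_lie k is the degree k part of the Lie subring of T(Z^J) generated by
   the basis, i.e. L_k(Z^J). *)
Inductive free_lie (J : choiceType) : nat -> tens J -> Prop :=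
| lie_gen j : free_lie 1 (tgen j)
| lie_bracket k l u v :
    free_lie k u -> free_lie l v -> free_lie (k + l) (bracket u v)
| lie_zero k : free_lie k 0
| lie_sub k u v : free_lie k u -> free_lie k v -> free_lie k (u - v).

(* For a free group G with basis b and k >= 1, the graph of
   Gamma_k G -> Gamma_k G / Gamma_(k+1) G ~ L_k(Z^J), where Z^J = G^ab. *)
Inductive lcs_class (J : choiceType) (G : groupType) (b : J -> G) :
    nat -> G -> tens J -> Prop :=
| lc_gen j : lcs_class b 1 (b j) (tgen j)
| lc_comm k x y u v : lcs_class b 1 x u -> lcs_class b k y v ->
    lcs_class b k.+1 [~ x, y]%g (bracket u v)
| lc_one k : lcs_class b k 1%g 0
| lc_mul k x y u v : lcs_class b k x u -> lcs_class b k y v ->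
    lcs_class b k (x * y)%g (u + v)
| lc_inv k x u : lcs_class b k x u -> lcs_class b k x^-1%g (- u)
| lc_next k x : lcs k.+1 x -> lcs_class b k x 0.

(* A system of meridians [inl i] and parallels [inr i]: based loops freely
   generating pi_1(Sigma), the meridians bounding in V and the parallels freely
   generating pi_1(V), whose product of commutators is the boundary curve, as
   obtained from the usual pictures of Sigma and V.  Their classes form a
   symplectic basis of H = H_1(Sigma) = pi_1(Sigma)^ab, indexed by hidx g.
   Those of the meridians span A = ker (H -> H'), and the images of the
   parallels form a basis, indexed by 'I_g, of H' = H_1(V). *)
Definition hidx (g : nat) : finType := ('I_g + 'I_g)%type.

Record marking (R : realType) (g : nat) (V : handlebody R g) (S : surface V) :=
  Marking {
    mk_gen :> hidx g -> pi1 R (sf_base S);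
    mk_free : free_basis mk_gen;
    mk_rim : pi1_class (sf_rim S) =
      (\prod_(i < g) [~ mk_gen (inl i), mk_gen (inr i)])%g;
    mk_meridian : forall i, pi1_map (sf_ptincl S) (mk_gen (inl i)) = 1%g;
    mk_parallel :
      free_basis (fun i : 'I_g => pi1_map (sf_ptincl S) (mk_gen (inr i))) }.

(* The intersection form in that basis.  Reversing the orientation changes its
   sign, which is immaterial: it is used twice, in the identification H ~ H^*
   and in the contraction by omega'. *)
Definition omega (g : nat) (a b : hidx g) : int :=
  match a, b with
  | inl i, inr j => (i == j)%:R
  | inr i, inl j => - (i == j)%:R
  | _, _ => 0
  end.

Section Johnson.
Context (g : nat).
Implicit Types t : hidx g -> tens (hidx g).

(* A family t : hidx g -> T(H) stands for \sum_a e_a (x) t_a in H (x) T(H). *)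

Definition in_D (k : nat) t : Prop :=
  (forall a, free_lie k.+1 (t a)) /\ \sum_a bracket (tgen a) (t a) = 0.

(* H -> H', e_(inl i) |-> 0 and e_(inr i) |-> e_i. *)
Definition hproj (a : hidx g) : tens 'I_g :=
  if a is inr i then tgen i else 0.

(* The coefficient of e_i in the image of t in H' (x) T(H') is that of
   e_(inr i) in t. *)
Definition in_G (k : nat) t : Prop :=
  in_D k t /\ forall i, tens_map hproj (t (inr i)) = 0.

(* h_1 (x) ... (x) h_m |-> omega'(e_(inl i), h_1) h_2 (x) ... (x) h_m. *)
Definition contract (i : 'I_g) : tens 'I_g -> tens 'I_g :=
  mmap intr (fun w : fmonom 'I_g =>
    if (w : seq 'I_g) is j :: w' then
      mkmalgU (FMonom w') (@omega g (inl i) (inr j))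
    else 0 : tens 'I_g).

(* T(H') ->> S(H') = Z[X_1, ..., X_g]. *)
Definition symm : tens 'I_g -> mpoly g int :=
  mmap intr (fun w : fmonom 'I_g => \prod_(j <- (w : seq 'I_g)) mpolyX int (mnm1 j)).

(* For t in G_k, the image of t in H (x) T(H') is
   \sum_i e_(inl i) (x) tens_map hproj (t (inl i)), in A (x) T(H'). *)
Definition lagrangian_trace t : mpoly g int :=
  \sum_(i < g) symm (contract i (tens_map hproj (t (inl i)))).

(* t is sent by H (x) L(H) ~ Hom(H, L(H)), x (x) l |-> (y |-> omega(x, y) l),
   to this homomorphism; u is an element of H = T_1(H). *)
Definition hom_of t (u : tens (hidx g)) : tens (hidx g) :=
  \sum_a t a *~ (\sum_b omega a b * mcoeff (fmu b) u).

Context (R : realType) (V : handlebody R g) (S : surface V) (m : marking S).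

Definition in_johnson (k : nat) (f : homeo_rel S) : Prop :=
  forall x : pi1 R (sf_base S), lcs k.+1 (pi1_map (hr_pt f) x * x^-1)%g.

(* The graph of tau_k: t = tau_k(f). *)
Definition johnson (k : nat) (f : homeo_rel S) t : Prop :=
  (forall a, free_lie k.+1 (t a)) /\
  forall (x : pi1 R (sf_base S)) (u : tens (hidx g)), lcs_class m 1 x u ->
    lcs_class m k.+1 (pi1_map (hr_pt f) x * x^-1)%g (hom_of t u).

End Johnson.

(* Main.v *)
Require Import Defs.
From HB Require Import structures.
From mathcomp Require Import all_boot all_order all_algebra.
From mathcomp Require Import all_classical all_reals topology normedtype.
From mathcomp Require Import -(notations) mpoly monalg.
From mathcomp Require Import perm finmap ring zify.

(** A mapping class f in the handlebody group induces automorphisms phi of the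
    free group pi_1(Sigma) and phi' of the free group pi_1(V), compatible with
    the projection p.  Johnson classes are read off from Magnus-type
    representations of these free groups into principal units of filtered
    matrix rings.  With strictly triangular integer matrices, phi' p = p phi
    gives membership in the kernel of D_k(H) -> D_k(H'), and the invariance of
    the boundary word gives the bracket condition.

    The Lagrangian trace of tau_k(f) is Morita's trace of phi'.  Send the basis
    of pi_1(V) to powers T^(v_i) and let M be the Fox Jacobian of phi' over
    Z[T, 1/T].  By the chain rule M is invertible, so det M is a unit, i.e. a
    monomial up to sign; on the other hand
    det M = 1 + (T - 1)^k P(v) mod (T - 1)^(k+1), where P is the trace.  As
    k >= 2, the monomial agrees with 1 to second order at T = 1, hence is 1,
    and P(v) = 0 for all v. *)

Set Implicit Arguments.
Unset Strict Implicit.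
Unset Printing Implicit Defensive.

Import Order.TTheory GRing.Theory Num.Theory numFieldNormedType.Exports.
Local Open Scope ring_scope.

(** * Evaluation of tensors in a ring *)

Section TensorEvaluation.
Context (J : choiceType) (A : nzRingType) (n : J -> A).

Definition word_eval (w : fmonom J) : A := \prod_(j <- (w : seq J)) n j.

Lemma word_eval_mmorphism : mmorphism word_eval.
Proof.
split=> [v w|]; rewrite /word_eval; last by rewrite fm1 big_nil.
by rewrite fmM big_cat.
Qed.

HB.instance Definition _ :=
  isMultiplicative.Build (fmonom J) A word_eval word_eval_mmorphism.

(** The universal property of the tensor algebra. [tens_map] is convertible to the case where [A] is
    itself a tensor algebra, and later proofs pass between the two by conversion. *)
Definition tens_eval : tens J -> A := mmap intr word_eval.

HB.instance Definition _ :=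
  GRing.isZmodMorphism.Build (tens J) A tens_eval (@mmap_is_additive _ _ _ _ _).

Lemma tens_eval_monoid_morphism : monoid_morphism tens_eval.
Proof.
split; first exact: mmap1.
by case: (@commr_mmap_is_multiplicative _ _ _ intr word_eval _) => // u w w';
   apply/commr_sym/commr_int.
Qed.

HB.instance Definition _ := GRing.isMonoidMorphism.Build (tens J) A tens_eval
  tens_eval_monoid_morphism.

Lemma tens_eval_gen j : tens_eval (tgen j) = n j.
Proof. by rewrite /tens_eval /tgen mmapU mul1r /word_eval fmuE big_seq1. Qed.

Lemma tens_evalE u :
  tens_eval u = \sum_(w <- msupp u) (mcoeff w u)%:~R * word_eval w.
Proof. exact: mmapE. Qed.

Lemma tens_eval_bracket u v :
  tens_eval (bracket u v) = bracket (tens_eval u) (tens_eval v).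
Proof. by rewrite /bracket rmorphB !rmorphM. Qed.

End TensorEvaluation.

Lemma tens_eval_map (J K : choiceType) (A : nzRingType) (q : J -> tens K)
    (n : K -> A) (u : tens J) :
  tens_eval n (tens_map q u) = tens_eval (tens_eval n \o q) u.
Proof.
rewrite -[tens_map q]/(tens_eval q) [tens_eval q u]tens_evalE [RHS]tens_evalE.
rewrite raddf_sum; apply: eq_bigr => w _.
rewrite [LHS](rmorphM (tens_eval n)) (rmorph_int (tens_eval n)).
by congr (_ * _); exact: (rmorph_prod (tens_eval n)).
Qed.

(** * Filtered rings *)

Record filtration (A : nzRingType) := Filtration {
  fil :> nat -> A -> Prop;
  fil0 : forall k, fil k 0;
  filB : forall k x y, fil k x -> fil k y -> fil k (x - y);
  filM : forall k l x y, fil k x -> fil l y -> fil (k + l) (x * y);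
  fil_le : forall l k x, (k <= l)%N -> fil l x -> fil k x;
  fil1 : fil 0 1 }.

Section FiltrationTheory.
Context (A : nzRingType) (F : filtration A).
Implicit Types x y z : A.

Lemma filN k x : F k x -> F k (- x).
Proof. by move=> h; rewrite -sub0r; apply: filB => //; exact: fil0. Qed.

Lemma filD k x y : F k x -> F k y -> F k (x + y).
Proof. by move=> hx hy; rewrite -[y]opprK; apply/filB/filN. Qed.

Lemma filM_le m k l x y : (m <= k + l)%N -> F k x -> F l y -> F m (x * y).
Proof. by move=> h hx hy; apply: fil_le h (filM hx hy). Qed.

Lemma fil_sum k (I : Type) (r : seq I) (P : pred I) (E : I -> A) :
  (forall i, P i -> F k (E i)) -> F k (\sum_(i <- r | P i) E i).
Proof.
by move=> h; apply: (big_ind (F k)) => //; [exact: fil0|exact: filD].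
Qed.

Lemma filX k x n : F k x -> F (k * n)%N (x ^+ n).
Proof.
move=> h; elim: n => [|n IH]; first by rewrite muln0; exact: fil1.
by rewrite exprS mulnS; exact: filM.
Qed.

Lemma fil_int k x (c : int) : F k x -> F k (c%:~R * x).
Proof.
move=> h; have hn (m : nat) : F k (m%:R * x).
  by rewrite mulr_natl; elim: m => [|m IH]; [exact: fil0|rewrite mulrS; exact: filD].
by case: c => m; [exact: hn|rewrite NegzE mulrNz mulNr; exact/filN/hn].
Qed.

Lemma fil_trans k y x z : F k (x - y) -> F k (y - z) -> F k (x - z).
Proof. by move=> hx hz; rewrite -(subrKA y); exact: filD. Qed.

Lemma fil_congr k x y : F k (x - y) -> F k y -> F k x.
Proof. by move=> h hy; rewrite -[x](subrK y); exact: filD. Qed.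

Lemma filBC k x y : F k (x - y) -> F k (y - x).
Proof. by move=> /filN; rewrite opprB. Qed.

Lemma fil_congrM k l m x x' y y' : F k (x - x') -> F l y -> F m x' ->
  forall p r, (r <= k + l)%N -> (r <= m + p)%N -> F p (y - y') ->
  F r (x * y - x' * y').
Proof.
move=> hx hy hx' p r h1 h2 hp.
have -> : x * y - x' * y' = (x - x') * y + x' * (y - y').
  by rewrite mulrBl mulrBr addrA subrK.
by apply: filD; [exact: filM_le h1 hx hy|exact: filM_le h2 hx' hp].
Qed.

Lemma fil_bracket k l m x y : (m <= k + l)%N -> F k x -> F l y -> F m (bracket x y).
Proof.
by move=> h hx hy; apply: filB; [exact: filM_le hx hy|apply: filM_le hy hx; rewrite addnC].
Qed.

End FiltrationTheory.

Section Bracket.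
Context (A : nzRingType).
Implicit Types x y z : A.

Lemma bracketBl x y z : bracket (x - y) z = bracket x z - bracket y z.
Proof. by rewrite /bracket mulrBl mulrBr !opprB addrACA [RHS]addrACA [- (y * z) + _]addrC. Qed.

Lemma bracketBr x y z : bracket z (x - y) = bracket z x - bracket z y.
Proof. by rewrite /bracket mulrBl mulrBr !opprB addrACA [RHS]addrACA [- (z * y) + _]addrC. Qed.

Lemma bracket1l x : bracket 1 x = 0.
Proof. by rewrite /bracket mul1r mulr1 subrr. Qed.

Lemma bracket1r x : bracket x 1 = 0.
Proof. by rewrite /bracket mul1r mulr1 subrr. Qed.

Lemma bracket_sub1 x y : bracket (x - 1) (y - 1) = bracket x y.
Proof. by rewrite bracketBl !bracketBr !bracket1l !bracket1r !subr0. Qed.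

End Bracket.

(** * Principal units and soundness of lower central series classes *)

(** The inverse is part of the data because [A] is an arbitrary ring; it must be congruent to 1 as
    well, so that these elements form a group. Freeness of a group can then be applied with this
    group as target. *)
Record principal_unit (A : nzRingType) (F : filtration A) := PrincipalUnit {
  pu_val :> A;
  pu_inv : A;
  pu_valK : pu_val * pu_inv = 1;
  pu_invK : pu_inv * pu_val = 1;
  pu_val_fil : F 1 (pu_val - 1);
  pu_inv_fil : F 1 (pu_inv - 1) }.

HB.instance Definition _ A F := gen_eqMixin (@principal_unit A F).
HB.instance Definition _ A F := gen_choiceMixin (@principal_unit A F).

Section PrincipalUnits.
Context (A : nzRingType) (F : filtration A).
Implicit Types x y z : principal_unit F.

Lemma principal_unit_inj x y : pu_val x = pu_val y -> x = y.
Proof.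
case: x y => [u u' K K' f f'] [v v' L L' h h'] /= uv; case: _ / uv in L L' h *.
have uv' : u' = v' by rewrite -[u']mulr1 -L mulrA K' mul1r.
by case: _ / uv' in L L' h' *; congr PrincipalUnit; exact: Prop_irrelevance.
Qed.

Lemma fil_mul_sub1 (u v : A) : F 1 (u - 1) -> F 1 (v - 1) -> F 1 (u * v - 1).
Proof.
move=> hu hv; rewrite -[X in _ - X](mulr1 1).
have h01 w : F 1 w -> F 0 w by exact: fil_le.
apply: (fil_congrM (l := 0) hu _ (fil1 F) (p := 1)) => //.
exact: fil_congr (h01 _ hv) (fil1 F).
Qed.

Definition pu_one : principal_unit F :=
  PrincipalUnit (mulr1 1) (mulr1 1)
    (eq_ind_r (F 1) (fil0 F 1) (subrr 1)) (eq_ind_r (F 1) (fil0 F 1) (subrr 1)).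

Lemma pu_mul_valK x y : pu_val x * pu_val y * (pu_inv y * pu_inv x) = 1.
Proof. by rewrite mulrA -(mulrA (pu_val x)) pu_valK mulr1 pu_valK. Qed.

Lemma pu_mul_invK x y : pu_inv y * pu_inv x * (pu_val x * pu_val y) = 1.
Proof. by rewrite mulrA -(mulrA (pu_inv y)) pu_invK mulr1 pu_invK. Qed.

Definition pu_mul x y : principal_unit F :=
  PrincipalUnit (pu_mul_valK x y) (pu_mul_invK x y)
    (fil_mul_sub1 (pu_val_fil x) (pu_val_fil y))
    (fil_mul_sub1 (pu_inv_fil y) (pu_inv_fil x)).

Definition pu_invg x : principal_unit F :=
  PrincipalUnit (pu_invK x) (pu_valK x) (pu_inv_fil x) (pu_val_fil x).

Lemma pu_mulA : associative pu_mul.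
Proof. by move=> x y z; apply: principal_unit_inj; rewrite /= mulrA. Qed.

Lemma pu_mul1 : left_id pu_one pu_mul.
Proof. by move=> x; apply: principal_unit_inj; rewrite /= mul1r. Qed.

Lemma pu_mulr1 : right_id pu_one pu_mul.
Proof. by move=> x; apply: principal_unit_inj; rewrite /= mulr1. Qed.

Lemma pu_mulV : left_inverse pu_one pu_invg pu_mul.
Proof. by move=> x; apply: principal_unit_inj; rewrite /= pu_invK. Qed.

Lemma pu_mulrV : right_inverse pu_one pu_invg pu_mul.
Proof. by move=> x; apply: principal_unit_inj; rewrite /= pu_valK. Qed.

HB.instance Definition _ := isGroup.Build (principal_unit F)
  pu_mulA pu_mul1 pu_mulr1 pu_mulV pu_mulrV.

End PrincipalUnits.

Lemma morph_group1 (G K : groupType) (f : G -> K) :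
  {morph f : x y / (x * y)%g} -> f 1%g = 1%g.
Proof. by move=> fM; apply: (mulgI (f 1%g)); rewrite -fM !mulg1. Qed.

Lemma morph_groupV (G K : groupType) (f : G -> K) :
  {morph f : x y / (x * y)%g} -> {morph f : x / x^-1%g}.
Proof. by move=> fM x; apply: (mulgI (f x)); rewrite -fM !mulgV morph_group1. Qed.

Record representation (G : groupType) (A : nzRingType) (F : filtration A) :=
  Representation {
    rep :> G -> A;
    rep1 : rep 1%g = 1;
    repM : forall x y, rep (x * y)%g = rep x * rep y;
    rep_fil : forall x, F 1 (rep x - 1) }.

Section Representations.
Context (G : groupType) (A : nzRingType) (F : filtration A).

Lemma repVK (rho : representation G F) x : rho x^-1%g * rho x = 1.
Proof. by rewrite -repM mulVg rep1. Qed.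

Lemma repKV (rho : representation G F) x : rho x * rho x^-1%g = 1.
Proof. by rewrite -repM mulgV rep1. Qed.

Lemma rep_fil0 (rho : representation G F) x : F 0 (rho x).
Proof. by apply: fil_congr (fil1 F); apply: fil_le (rep_fil rho x). Qed.

Lemma rep_pull_proof (K : groupType) (f : K -> G) (rho : representation G F) :
  {morph f : x y / (x * y)%g} ->
  rho (f 1%g) = 1 /\ forall x y, rho (f (x * y)%g) = rho (f x) * rho (f y).
Proof.
by move=> fM; split=> [|x y]; [rewrite (morph_group1 fM) rep1|rewrite fM repM].
Qed.

Definition rep_pull (K : groupType) (f : K -> G) (fM : {morph f : x y / (x * y)%g})
    (rho : representation G F) : representation K F :=
  @Representation K A F (rho \o f) (rep_pull_proof rho fM).1
    (rep_pull_proof rho fM).2 (fun x => rep_fil rho (f x)).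

Context (J : Type) (b : J -> G).

Lemma free_basis_rep (n n' : J -> A) : free_basis b ->
  (forall j, (1 + n j) * (1 + n' j) = 1) ->
  (forall j, (1 + n' j) * (1 + n j) = 1) ->
  (forall j, F 1 (n j)) -> (forall j, F 1 (n' j)) ->
  exists rho : representation G F, forall j, rho (b j) = 1 + n j.
Proof.
move=> bfree K K' f f'.
have sub1 u : F 1 u -> F 1 (1 + u - 1) by rewrite addrC addKr.
pose c j : principal_unit F :=
  PrincipalUnit (K j) (K' j) (sub1 _ (f j)) (sub1 _ (f' j)).
have [h [[hM hc] _]] := bfree _ c.
have h1 : pu_val (h 1%g) = 1 by rewrite (morph_group1 hM).
have hM' x y : pu_val (h (x * y)%g) = pu_val (h x) * pu_val (h y) by rewrite hM.
exists (@Representation G A F (fun x => pu_val (h x)) h1 hM' (fun x => pu_val_fil (h x))).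
by move=> j /=; rewrite hc.
Qed.

(** Both maps land in the units of [A]. These form a group of principal units for the trivial
    filtration [T], in which every element has every degree, so uniqueness in [free_basis]
    applies. *)
Lemma free_basis_uniq (r s : G -> A) : free_basis b ->
  r 1%g = 1 -> s 1%g = 1 ->
  (forall x y, r (x * y)%g = r x * r y) -> (forall x y, s (x * y)%g = s x * s y) ->
  (forall j, r (b j) = s (b j)) -> r =1 s.
Proof.
pose T := @Filtration A (fun _ _ => True) (fun _ => I) (fun _ _ _ _ _ => I)
  (fun _ _ _ _ _ _ => I) (fun _ _ _ _ _ => I) I.
move=> bfree r1 s1 rM sM rs.
have K (q : G -> A) : q 1%g = 1 -> (forall x y, q (x * y)%g = q x * q y) ->
  exists2 Q : G -> principal_unit T,
    {morph Q : x y / (x * y)%g} & forall x, pu_val (Q x) = q x.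
  move=> q1 qM.
  have h x : q x * q x^-1%g = 1 by rewrite -qM mulgV.
  have h' x : q x^-1%g * q x = 1 by rewrite -qM mulVg.
  exists (fun x => @PrincipalUnit A T _ _ (h x) (h' x) I I) => // x y.
  by apply: principal_unit_inj => /=.
have [Q QM Qr] := K r r1 rM; have [P PM Ps] := K s s1 sM.
have [u [_ uu]] := bfree _ (Q \o b).
have uQ : u = Q by apply: uu.
have uP : u = P.
  by apply: uu; split=> // j; apply: principal_unit_inj; rewrite /= Ps Qr rs.
by move=> x; rewrite -Qr -Ps -uQ uP.
Qed.

End Representations.

Section Soundness.
Context (J : choiceType) (G : groupType) (b : J -> G).
Context (A : nzRingType) (F : filtration A) (rho : representation G F).

(** Since the commutator is x^-1 y^-1 x y, factoring out x^-1 y^-1 leaves xy - yx, a bracket that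
    does not change when 1 is subtracted from both arguments. As the factor is congruent to 1, the
    group commutator is the ring bracket to leading order. *)
Lemma rep_commg x y :
  rho [~ x, y]%g - 1 = rho (x^-1 * y^-1)%g * bracket (rho x - 1) (rho y - 1).
Proof.
rewrite bracket_sub1 /bracket mulrBr -!repM commgEl conjgE; congr (rho _ - _).
  by rewrite !mulgA.
by rewrite -mulgA (mulgA y^-1%g) mulVg mul1g mulVg rep1.
Qed.

Lemma rep_commg_fil k l x y : F k (rho x - 1) -> F l (rho y - 1) ->
  F (k + l).+1 (rho [~ x, y]%g - 1 - bracket (rho x - 1) (rho y - 1)).
Proof.
move=> hx hy; rewrite rep_commg -{2}[bracket _ _]mul1r -mulrBl.
by apply: (filM_le _ (rep_fil rho _) (fil_bracket (leqnn _) hx hy)).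
Qed.

Lemma rep_lcs k x : lcs k x -> F k (rho x - 1).
Proof.
(* [lcs G 0] is the whole group, by truncated predecessor, and degree 0 is weaker than degree 1. *)
case: k => [|k]; first by move=> _; apply: fil_le (rep_fil rho x).
rewrite /lcs /=; elim: k x => [|k IH] x; first by move=> _; exact: rep_fil.
move=> /=; elim=> {x} [_ [x _ [y hy <-]]||x y _ hx _ hy|x _ hx].
- apply: (@fil_congr _ _ _ _ (bracket (rho x - 1) (rho y - 1))).
    by apply: fil_le (rep_commg_fil (rep_fil rho x) (IH _ hy)).
  by apply: (fil_bracket _ (rep_fil rho x) (IH _ hy)).
- by rewrite rep1 subrr; exact: fil0.
- have -> : rho (x * y)%g - 1 = (rho x - 1) * rho y + (rho y - 1).
    by rewrite repM mulrBl mul1r addrA subrK.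
  by apply: filD => //; rewrite -[k.+2]addn0; apply: filM => //; exact: rep_fil0.
- have -> : rho x^-1%g - 1 = - ((rho x - 1) * rho x^-1%g).
    by rewrite mulrBl mul1r repKV opprB.
  by apply/filN; rewrite -[k.+2]addn0; apply: filM => //; exact: rep_fil0.
Qed.

Context (n : J -> A).
Hypothesis rho_gen : forall j, rho (b j) = 1 + n j.
Let ev := tens_eval n.

(** The class of [x] is the leading term of [rho x - 1] in any such representation. Classes are thus
    compared by evaluation, by induction on their derivation, without constructing the isomorphism
    of the graded quotients with the free Lie ring. The first conjunct controls the product terms in
    the induction. *)
Lemma lcs_class_rep k x u : lcs_class b k x u ->
  F k (ev u) /\ F k.+1 (rho x - 1 - ev u).
Proof.
elim=> {k x u} [j|k x y u v _ [hu hx] _ [hv hy]|k|k x y u v _ [hu hx] _ [hv hy]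
  |k x u _ [hu hx]|k x hx].
- have e : rho (b j) - 1 = n j by rewrite rho_gen addrC addKr.
  rewrite /ev tens_eval_gen e subrr; split; last exact: fil0.
  by rewrite -e; exact: rep_fil.
- rewrite /ev tens_eval_bracket -/ev; split.
    by rewrite -add1n; apply: (fil_bracket _ hu hv).
  have hy' : F k (rho y - 1) by apply: fil_congr hv; apply: fil_le hy.
  apply: (@fil_trans _ _ _ (bracket (rho x - 1) (rho y - 1))).
    by apply: fil_le (rep_commg_fil (rep_fil rho x) hy').
  apply: (@fil_trans _ _ _ (bracket (ev u) (rho y - 1))).
    by rewrite -bracketBl; apply: (fil_bracket _ hx hy').
  by rewrite -bracketBr; apply: (fil_bracket _ hu hy).
- by rewrite rep1 /ev raddf0 !subrr; split; exact: fil0.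
- rewrite /ev (raddfD (tens_eval n)) -/ev; split; first exact: filD.
  have -> : rho (x * y)%g - 1 - (ev u + ev v) =
      (rho x - 1) * (rho y - 1) + ((rho x - 1 - ev u) + (rho y - 1 - ev v)).
    rewrite mulrBl mul1r mulrBr mulr1 -repM [X in _ = _ + X]addrACA -opprD addrA.
    by congr (_ - _); rewrite addrA addrAC subrK addrA subrK.
  apply: filD; last exact: filD.
  rewrite -addn1; apply: filM (rep_fil rho y).
  by apply: fil_congr hu; apply: fil_le hx.
- rewrite /ev (raddfN (tens_eval n)) -/ev; split; first exact: filN.
  have -> : rho x^-1%g - 1 - - ev u =
      - (rho x - 1 - ev u) - (rho x^-1%g - 1) * (rho x - 1).
    rewrite mulrBl mul1r mulrBr mulr1 repVK opprB.
    by rewrite [X in _ = _ + X]opprB addrA subrK opprB opprK addrC.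
  apply: filB; first exact: filN.
  rewrite -add1n; apply: filM (rep_fil rho _) _.
  by apply: fil_congr hu; apply: fil_le hx.
- rewrite /ev raddf0 subr0; split; [exact: fil0|exact: rep_lcs].
Qed.

End Soundness.

(** * First-order variation of commutators and products *)

Section CommutatorPerturbation.
Context (G : groupType) (A : nzRingType) (F : filtration A).
Context (rho : representation G F).

Lemma rep_quotient k x x' u : F k (u : A) -> F k.+1 (rho (x' * x^-1)%g - 1 - u) ->
  F k.+1 (rho x' - rho x - u).
Proof.
move=> hu h; have -> : rho x' - rho x - u =
    (rho (x' * x^-1)%g - 1 - u) * rho x + u * (rho x - 1).
  rewrite mulrBl (mulrBl _ _ 1) mul1r -repM -mulgA mulVg mulg1.
  by rewrite mulrBr mulr1 addrA subrK.
apply: filD; first by rewrite -[k.+1]addn0; apply: filM h (rep_fil0 _ _).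
by rewrite -addn1; apply: filM hu (rep_fil _ _).
Qed.

Lemma rep_inv_congr k x x' : F k (rho x' - rho x) -> F k (rho x'^-1%g - rho x^-1%g).
Proof.
move=> h; have -> : rho x'^-1%g - rho x^-1%g =
    - (rho x'^-1%g * ((rho x' - rho x) * rho x^-1%g)).
  by rewrite mulrBl repKV mulrBr mulrA repVK mul1r mulr1 opprB.
apply: filN; rewrite -[k]add0n; apply: filM (rep_fil0 _ _) _.
by rewrite -[k]addn0; apply: filM h (rep_fil0 _ _).
Qed.

(** The variation of a commutator is the linearised bracket. By [rep_commg] the commutator is 1 plus
    a prefactor times a bracket [W] of degree 2; the prefactor varies in degree k+1, which only
    contributes in degree k+3. *)
Lemma rep_commg_perturb k x y x' y' u v ex ey : (0 < k)%N ->
  F k.+1 u -> F k.+2 (rho (x' * x^-1)%g - 1 - u) ->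
  F k.+1 v -> F k.+2 (rho (y' * y^-1)%g - 1 - v) ->
  F 1 ex -> F 2 (rho x - 1 - ex) -> F 2 (rho y - 1 - ey) ->
  F k.+3 (rho [~ x', y']%g - rho [~ x, y]%g - (bracket u ey + bracket ex v)).
Proof.
move=> k0 hu /(rep_quotient hu) hx hv /(rep_quotient hv) hy hex hxe hye.
set dl := bracket u ey + bracket ex v.
have hxx : F k.+1 (rho x' - rho x) by apply: fil_congr hu; apply: fil_le hx.
have hyy : F k.+1 (rho y' - rho y) by apply: fil_congr hv; apply: fil_le hy.
have hey : F 1 ey.
  by apply: (@fil_congr _ _ _ _ (rho y - 1) (fil_le _ (filBC hye)) (rep_fil _ _)).
have hdl : F k.+2 dl.
  apply: filD; [apply: (fil_bracket _ hu hey)|apply: (fil_bracket _ hex hv)] => //.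
  by rewrite addn1.
pose W := bracket (rho x) (rho y); pose W' := bracket (rho x') (rho y').
have hW : F 2 W.
  by rewrite /W -bracket_sub1; apply: (fil_bracket _ (rep_fil _ _) (rep_fil _ _)).
have hWW : F k.+3 (W' - W - dl).
  have -> : W' - W - dl = (bracket (rho x' - rho x) (rho y' - 1) - bracket u ey) +
      (bracket (rho x - 1) (rho y' - rho y) - bracket ex v).
    rewrite /W' /W /dl [RHS]addrACA -opprD; congr (_ - _).
    rewrite [bracket _ (rho y' - 1)]bracketBr bracket1r subr0.
    rewrite [bracket (rho x - 1) _]bracketBl bracket1l subr0.
    by rewrite bracketBl bracketBr subrKA.
  apply: filD.
    apply: (@fil_trans _ _ _ (bracket u (rho y' - 1))).
      by rewrite -bracketBl; apply: (fil_bracket _ hx (rep_fil _ _)); rewrite addn1.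
    rewrite -bracketBr; apply: (fil_bracket (l := 2) _ hu); first by rewrite addn2.
    apply: (@fil_trans _ _ _ (rho y - 1)) hye.
    (* Positivity of [k] enters here: [rho y'] and [rho y] agree modulo degree 2. *)
    by rewrite opprB addrA subrK; apply: fil_le hyy.
  apply: (@fil_trans _ _ _ (bracket ex (rho y' - rho y))).
    by rewrite -bracketBl; apply: (fil_bracket _ hxe hyy).
  by rewrite -bracketBr; apply: (fil_bracket _ hex hy).
pose Z := rho (x^-1 * y^-1)%g; pose Z' := rho (x'^-1 * y'^-1)%g.
have hZZ : F k.+1 (Z' - Z).
  rewrite /Z /Z' !repM; apply: (fil_congrM (rep_inv_congr hxx)
    (rep_fil0 _ _) (rep_fil0 _ _) _ _ (rep_inv_congr hyy)); by rewrite ?addn0.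
(* The difference is Z'W' - ZW - dl, split so that each summand has degree k+3: 0 + (k+3), 1 + (k+2)
   and (k+1) + 2. *)
have -> : rho [~ x', y']%g - rho [~ x, y]%g - dl =
    Z' * (W' - W - dl) + ((Z' - 1) * dl + (Z' - Z) * W).
  rewrite -[rho [~ x', y']%g](subrK 1) -[rho [~ x, y]%g](subrK 1) !rep_commg !bracket_sub1.
  rewrite -/W -/W' -/Z -/Z' opprD addrACA subrr addr0.
  clearbody W W' Z Z' dl; rewrite !mulrBr !mulrBl mul1r.
  by rewrite [RHS]addrA subrKA addrAC [RHS]addrAC subrKA addrAC.
apply: filD; first by rewrite -[k.+3]add0n; apply: filM hWW; exact: rep_fil0.
apply: filD; first by rewrite -add1n; apply: filM hdl; exact: rep_fil.
by rewrite -addn2; apply: filM hW.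
Qed.

(** All factors are congruent to 1, so to leading order the variations of the factors add up, even
    though the ring is noncommutative. *)
Lemma rep_prod_perturb k (I : Type) (r : seq I) (c c' : I -> G) (dl : I -> A) :
  (forall i, F k (dl i)) -> (forall i, F k.+1 (rho (c' i) - rho (c i) - dl i)) ->
  F k.+1 (rho (\prod_(i <- r) c' i)%g - rho (\prod_(i <- r) c i)%g -
          \sum_(i <- r) dl i).
Proof.
move=> hdl hc; elim: r => [|i r IH].
  by rewrite !big_nil !subrr; exact: fil0.
rewrite !big_cons !repM.
set P' := rho (\prod_(j <- r) c' j)%g; set P := rho (\prod_(j <- r) c j)%g.
set D := \sum_(j <- r) dl j.
have hD : F k D by apply: fil_sum.
have -> : rho (c' i) * P' - rho (c i) * P - (dl i + D) =
    ((rho (c' i) - rho (c i) - dl i) * P' + dl i * (P' - 1)) +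
    (rho (c i) * (P' - P - D) + (rho (c i) - 1) * D).
  clearbody P P' D; rewrite !mulrBr !mulrBl mulr1 mul1r !subrKA.
  by rewrite [RHS]addrACA subrKA opprD.
apply: filD; apply: filD.
- by rewrite -[k.+1]addn0; apply: filM (hc i) (rep_fil0 _ _).
- by rewrite -addn1; apply: filM (hdl i) (rep_fil _ _).
- by rewrite -[k.+1]add0n; apply: filM (rep_fil0 _ _) IH.
- by rewrite -add1n; apply: filM (rep_fil _ _) hD.
Qed.

End CommutatorPerturbation.

(** * Homogeneous tensors and word matrices *)

Section Homogeneity.
Context (J : choiceType).
Implicit Types u v : tens J.

Definition homogeneous (k : nat) u : Prop :=
  forall w : fmonom J, mcoeff w u != 0 -> size w = k.

Lemma homogeneous0 k : homogeneous k 0.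
Proof. by move=> w; rewrite mcoeff0 eqxx. Qed.

Lemma homogeneousB k u v : homogeneous k u -> homogeneous k v -> homogeneous k (u - v).
Proof.
move=> hu hv w; rewrite mcoeffB; have [u0|/hu//] := eqVneq (mcoeff w u) 0.
by rewrite u0 sub0r oppr_eq0 => /hv.
Qed.

Lemma homogeneousD k u v : homogeneous k u -> homogeneous k v -> homogeneous k (u + v).
Proof.
move=> hu hv; rewrite -[v]opprK; apply: homogeneousB => //.
by rewrite -sub0r; apply: homogeneousB => //; exact: homogeneous0.
Qed.

Lemma homogeneous_gen j : homogeneous 1 (tgen j).
Proof.
by move=> w; rewrite mcoeffU1 fmuE; case: (FMonom [:: j] =P w) => [<-|_]; rewrite ?eqxx.
Qed.

Lemma homogeneousM k l u v :
  homogeneous k u -> homogeneous l v -> homogeneous (k + l) (u * v).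
Proof.
move=> hu hv w; rewrite mcoeff_neq0 => /msuppM_le[w1 [w2 [h1 h2 ->]]].
by rewrite fmM size_cat (hu w1) ?(hv w2)// mcoeff_neq0.
Qed.

Lemma homogeneous_bracket k l u v :
  homogeneous k u -> homogeneous l v -> homogeneous (k + l) (bracket u v).
Proof.
move=> hu hv; apply: homogeneousB; first exact: homogeneousM.
by rewrite addnC; exact: homogeneousM.
Qed.

Lemma homogeneous_sum k (I : Type) (r : seq I) (E : I -> tens J) :
  (forall i, homogeneous k (E i)) -> homogeneous k (\sum_(i <- r) E i).
Proof.
move=> h; apply: (big_ind (homogeneous k)) => //; [exact: homogeneous0|].
exact: homogeneousD.
Qed.

Lemma homogeneous_free_lie k u : free_lie k u -> homogeneous k u.
Proof.
elim=> {k u} [j|k l u v _ hu _ hv|k|k u v _ hu _ hv].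
- exact: homogeneous_gen.
- exact: homogeneous_bracket.
- exact: homogeneous0.
- exact: homogeneousB.
Qed.

Lemma homogeneous_size k u (w : fmonom J) : homogeneous k u -> w \in msupp u -> size w = k.
Proof. by move=> hu; rewrite -mcoeff_neq0; exact: hu. Qed.

End Homogeneity.

Lemma homogeneous_map (J K : choiceType) (q : J -> tens K) k (u : tens J) :
  (forall j, homogeneous 1 (q j)) -> homogeneous k u -> homogeneous k (tens_map q u).
Proof.
move=> hq hu; rewrite -[tens_map q]/(tens_eval q) tens_evalE.
rewrite big_seq; apply: (big_ind (homogeneous k)).
- exact: homogeneous0.
- by move=> x y; exact: homogeneousD.
move=> w /(homogeneous_size hu) <-; rewrite mulrzl /word_eval; elim: (w : seq J) => [|j s IH].
  rewrite big_nil => v; rewrite raddfMz /= mcoeff1.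
  by case: (v =P _) => [-> _|_]; rewrite ?fm1 ?mul0rz ?eqxx.
by rewrite big_cons -mulrzAr -[size _]/(1 + size s)%N; apply: homogeneousM.
Qed.

(** * Filtrations on matrix rings *)

Section MatrixFiltration.
Context (A : nzRingType) (F : filtration A) (d : nat).

(** Each step to the right lowers the required degree by one, with truncation at 0. Over the
    discrete filtration, degree k means support on or above the k-th superdiagonal; for two-by-two
    Laurent matrices, the entry (0,1) may have one degree less than the diagonal. *)
Definition mx_fil (k : nat) (M : 'M[A]_d.+1) : Prop :=
  forall i j : 'I_d.+1, F (k + i - j)%N (M i j).

Lemma mx_fil0 k : mx_fil k 0.
Proof. by move=> i j; rewrite mxE; exact: fil0. Qed.

Lemma mx_filB k M N : mx_fil k M -> mx_fil k N -> mx_fil k (M - N).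
Proof. by move=> hM hN i j; rewrite !mxE; exact: filB. Qed.

Lemma mx_filM k l M N : mx_fil k M -> mx_fil l N -> mx_fil (k + l) (M * N).
Proof.
move=> hM hN i j; rewrite mxE; apply: fil_sum => a _.
by apply: (filM_le _ (hM i a) (hN a j)); lia.
Qed.

Lemma mx_fil_le l k M : (k <= l)%N -> mx_fil l M -> mx_fil k M.
Proof. by move=> kl hM i j; apply: fil_le (hM i j); lia. Qed.

Lemma mx_fil1 : mx_fil 0 1.
Proof.
move=> i j; rewrite mxE; case: eqP => [<-|_]; last exact: fil0.
by rewrite add0n subnn; exact: fil1.
Qed.

Definition mx_filtration : filtration 'M[A]_d.+1 :=
  Filtration mx_fil0 mx_filB mx_filM mx_fil_le mx_fil1.

End MatrixFiltration.

Section DiscreteFiltration.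
Context (A : nzRingType).

Definition discrete_fil (k : nat) (x : A) : Prop := (0 < k)%N -> x = 0.

Lemma discrete_filM k l x y :
  discrete_fil k x -> discrete_fil l y -> discrete_fil (k + l) (x * y).
Proof.
move=> hx hy; rewrite /discrete_fil addn_gt0 => /orP[/hx->|/hy->].
- by rewrite mul0r.
- by rewrite mulr0.
Qed.

Definition discrete_filtration : filtration A.
Proof.
apply: (@Filtration A discrete_fil).
- by [].
- by move=> k x y hx hy h; rewrite hx// hy// subr0.
- exact: discrete_filM.
- by move=> l k x kl hx k0; apply: hx; exact: leq_trans kl.
- by [].
Defined.

End DiscreteFiltration.

(** The geometric series in [- x] terminates because its terms of degree at least [d] vanish.
    Existence is informative so that inverses can be chosen for a whole family of generators. *)
Lemma nilpotent_principal_inverse (A : nzRingType) (F : filtration A) (d : nat) (x : A) :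
  (forall y, F d y -> y = 0) -> F 1 x ->
  {y | [/\ F 1 y, (1 + x) * (1 + y) = 1 & (1 + y) * (1 + x) = 1]}.
Proof.
move=> nil hx; pose s := \sum_(i < d.+1) (- x) ^+ i.
have hX i : F i ((- x) ^+ i) by rewrite -{1}[i]mul1n; apply/filX/filN.
have e : 1 - (- x) ^+ d.+1 = 1 by rewrite (nil _ (fil_le _ (hX d.+1))) ?subr0.
exists (s - 1); rewrite (addrC 1 (s - 1)) subrK; split.
- rewrite /s big_ord_recl expr0 addrC addKr; apply: fil_sum => i _.
  by apply: fil_le (hX _).
- by rewrite -[RHS]e -opprB subrX1 -mulNr opprB opprK.
- have -> : s * (1 + x) = (1 + x) * s.
    rewrite /s mulr_suml mulr_sumr; apply: eq_bigr => i _.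
    apply: commrD; first exact: commr1.
    by apply/commr_sym/commrX/commrN/commr_refl.
  by rewrite -[RHS]e -opprB subrX1 -mulNr opprB opprK.
Qed.

Section WordTest.
Context (J : choiceType).
Implicit Types (w : fmonom J) (u : tens J).

(* The path matrices of the word w: the product of those of the letters of w'
   has a nonzero upper right corner only if w' = w. *)
Definition word_mx w (j : J) : 'M[int]_((size w).+1) :=
  \matrix_(a, c) ((a.+1 == c :> nat) && (nth j w a == j))%:R.

(** Each letter moves one column to the right, provided it matches the letter of [w] at that place;
    a product started in row [a] reaches the last column exactly when it spells the suffix of [w]
    from [a]. The general row is what the induction on [s] needs. *)
Lemma word_eval_word_mx w (s : fmonom J) a :
  word_eval (word_mx w) s a ord_max = ((s : seq J) == drop a w)%:R.
Proof.
rewrite /word_eval; elim: (s : seq J) a => {s} [|j s IH] a.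
  rewrite big_nil mxE -val_eqE /= [in RHS]eq_sym -size_eq0 size_drop subn_eq0 eqn_leq.
  by rewrite leq_ord.
rewrite big_cons mxE; have [aw|wa] := ltnP a (size w).
  rewrite (bigD1 (Ordinal (aw : a.+1 < (size w).+1)%N))//= [X in _ + X]big1 ?addr0 => [|c ca].
    by rewrite mxE IH /= eqxx (drop_nth j aw) eqseq_cons -natrM mulnb eq_sym.
  rewrite mxE; case: eqP => [e|_]; last by rewrite mul0r.
  by case/eqP: ca; apply: val_inj.
rewrite drop_oversize// big1// => c _; rewrite mxE; case: eqP => [e|_]; last by rewrite mul0r.
by have := ltn_ord c; rewrite -e ltnS ltnNge wa.
Qed.

Lemma tens_eval_word_mx w u :
  tens_eval (word_mx w) u ord0 ord_max = mcoeff w u.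
Proof.
rewrite tens_evalE summxE.
transitivity (\sum_(v <- msupp u) mcoeff v u * (v == w)%:R).
  apply: eq_bigr => v _; rewrite mulrzl -scaler_int mxE intz word_eval_word_mx.
  by rewrite drop0 fmP.
have [h|h] := boolP (w \in msupp u).
  rewrite (big_fsetD1 w)//= eqxx mulr1 big_seq big1 ?addr0// => v.
  by rewrite in_fsetD1 => /andP[/negPf -> _]; rewrite mulr0.
rewrite mcoeff_outdom// big_seq big1// => v vu; case: eqP => [vw|_]; last by rewrite mulr0.
by rewrite -vw vu in h.
Qed.

Definition word_filtration w : filtration 'M[int]_((size w).+1) :=
  mx_filtration (discrete_filtration int) (size w).

Lemma word_mx_fil w j : word_filtration w 1 (word_mx w j).
Proof.
move=> a c; rewrite mxE => h; case: eqP => //= ac; move: h; rewrite -ac; lia.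
Qed.

Lemma word_filtration_nil w M : word_filtration w (size w).+1 M -> M = 0.
Proof.
move=> h; apply/matrixP => a c; rewrite mxE; apply: h.
by have := ltn_ord c; lia.
Qed.

(** For a word [w] of length k the matrices have size k+1, so degree k+1 forces them to vanish;
    their upper right corner is the coefficient of [w]. *)
Lemma homogeneous_eq0 k u : homogeneous k u ->
  (forall w, size w = k -> word_filtration w k.+1 (tens_eval (word_mx w) u)) ->
  u = 0.
Proof.
move=> hu h; apply/malgP => w; rewrite mcoeff0.
have [//|/hu wk] := eqVneq (mcoeff w u) 0.
have := h w wk; rewrite -[in k.+1]wk => {}h.
by rewrite -tens_eval_word_mx (word_filtration_nil h) mxE.
Qed.

Lemma free_word_rep (G : groupType) (b : J -> G) w : free_basis b ->
  exists rho : representation G (word_filtration w),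
    forall j, rho (b j) = 1 + word_mx w j.
Proof.
move=> bfree.
pose inv j := nilpotent_principal_inverse (@word_filtration_nil w) (@word_mx_fil w j).
apply: (@free_basis_rep _ _ _ _ b (word_mx w) (fun j => sval (inv j))) => // j.
- by case: (svalP (inv j)).
- by case: (svalP (inv j)).
- exact: word_mx_fil.
- by case: (svalP (inv j)).
Qed.

End WordTest.

(** * The image of the Johnson homomorphism *)

Section JohnsonImage.
Context (g k : nat) (G : groupType) (b : hidx g -> G) (phi : G -> G).
Hypothesis phiM : {morph phi : x y / (x * y)%g}.
Context (t : hidx g -> tens (hidx g)).
Hypothesis t_lie : forall a, free_lie k.+1 (t a).
Hypothesis t_class : forall x u, lcs_class b 1 x u ->
  lcs_class b k.+1 (phi x * x^-1)%g (hom_of t u).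

Lemma hom_of_gen c : hom_of t (tgen c) = \sum_a t a *~ omega a c.
Proof.
apply: eq_bigr => a _; congr (_ *~ _); rewrite (bigD1 c)//= big1 => [|d dc].
  by rewrite mcoeffU1 eqxx mulr1 addr0.
rewrite mcoeffU1 (_ : (fmu c == fmu d) = false) ?mulr0//.
by apply/negbTE; apply: contra dc => /eqP; rewrite !fmuE => -[->].
Qed.

Lemma hom_of_parallel i : hom_of t (tgen (inr i)) = t (inl i).
Proof.
rewrite hom_of_gen big_sumType /= [X in _ + X]big1 ?addr0 => [|j _]; last by rewrite mulr0z.
rewrite (bigD1 i)//= eqxx mulr1z big1 ?addr0// => j /negPf ->.
by rewrite mulr0z.
Qed.

Lemma hom_of_meridian i : hom_of t (tgen (inl i)) = - t (inr i).
Proof.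
rewrite hom_of_gen big_sumType /= [X in X + _]big1 ?add0r => [|j _]; last by rewrite mulr0z.
rewrite (bigD1 i)//= eqxx mulrN1z big1 ?addr0// => j /negPf ->.
by rewrite oppr0 mulr0z.
Qed.

Section Representation.
Context (A : nzRingType) (F : filtration A) (rho : representation G F).
Context (n : hidx g -> A).
Hypothesis rho_gen : forall a, rho (b a) = 1 + n a.

Lemma rep_johnson c : let u := tens_eval n (hom_of t (tgen c)) in
  F k.+1 u /\ F k.+2 (rho (phi (b c) * (b c)^-1)%g - 1 - u).
Proof. by apply: (lcs_class_rep rho_gen); apply: t_class; constructor. Qed.

Lemma rep_gen_fil a : F 1 (n a).
Proof. by have := rep_fil rho (b a); rewrite rho_gen addrC addKr. Qed.

End Representation.

(** The minus sign from [hom_of_meridian] swaps the arguments of the first bracket. Hence the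
    linearised variation of the boundary word is the bracket map defining D_k. *)
Lemma tens_eval_boundary (A : nzRingType) (n : hidx g -> A) :
  \sum_(i < g) (bracket (- tens_eval n (t (inr i))) (n (inr i)) +
                bracket (n (inl i)) (tens_eval n (t (inl i)))) =
  tens_eval n (\sum_a bracket (tgen a) (t a)).
Proof.
have ev_bracket a : bracket (n a) (tens_eval n (t a)) =
    tens_eval n (bracket (tgen a) (t a)).
  by rewrite tens_eval_bracket tens_eval_gen.
rewrite raddf_sum; transitivity (\sum_a bracket (n a) (tens_eval n (t a))).
  rewrite big_sumType /= -big_split /=; apply: eq_bigr => i _.
  rewrite addrC; congr (_ + _).
  by rewrite /bracket mulNr mulrN opprK addrC.
by apply: eq_bigr => a _; exact: ev_bracket.
Qed.

Let boundary := (\prod_(i < g) [~ b (inl i), b (inr i)])%g.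

(** The boundary word is fixed by [phi], so its variation in degree k+2 is zero. This variation is
    the sum of those of its commutators, which [tens_eval_boundary] turns into the bracket sum;
    words of length k+2 detect it. *)
Lemma johnson_bracket_eq0 : (0 < k)%N -> free_basis b -> phi boundary = boundary ->
  \sum_a bracket (tgen a) (t a) = 0.
Proof.
move=> k0 bfree phi_bd.
apply: (@homogeneous_eq0 _ k.+2) => [|w wk].
  apply: homogeneous_sum => a; rewrite -add1n; apply: homogeneous_bracket.
    exact: homogeneous_gen.
  exact: homogeneous_free_lie.
have [rho] := free_word_rep w bfree; move: (word_mx w) => n rho_gen.
pose ev := tens_eval n.
pose c i := [~ b (inl i), b (inr i)]%g.
pose c' i := [~ phi (b (inl i)), phi (b (inr i))]%g.
pose dl i := bracket (- ev (t (inr i))) (n (inr i)) + bracket (n (inl i)) (ev (t (inl i))).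
have hu i : word_filtration w k.+1 (- ev (t (inr i))) /\ word_filtration w k.+2
    (rho (phi (b (inl i)) * (b (inl i))^-1)%g - 1 - - ev (t (inr i))).
  by have := rep_johnson rho_gen (inl i); rewrite hom_of_meridian raddfN.
have hv i : word_filtration w k.+1 (ev (t (inl i))) /\ word_filtration w k.+2
    (rho (phi (b (inr i)) * (b (inr i))^-1)%g - 1 - ev (t (inl i))).
  by have := rep_johnson rho_gen (inr i); rewrite hom_of_parallel.
have hn a : word_filtration w 1 (n a) by exact: rep_gen_fil rho_gen a.
have hn2 a : word_filtration w 2 (rho (b a) - 1 - n a).
  by rewrite rho_gen addrAC addrK subrr; exact: fil0.
have hdl i : word_filtration w k.+2 (dl i).
  by apply: filD; [apply: (fil_bracket _ (hu i).1 (hn _)); rewrite addn1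
                  |apply: (fil_bracket _ (hn _) (hv i).1)].
have hc i : word_filtration w k.+3 (rho (c' i) - rho (c i) - dl i).
  exact: (rep_commg_perturb k0 (hu i).1 (hu i).2 (hv i).1 (hv i).2).
have := rep_prod_perturb (index_enum 'I_g) hdl hc.
have -> : (\prod_(i <- index_enum 'I_g) c' i)%g = phi boundary.
  rewrite /boundary; elim: (index_enum 'I_g) => [|i r IH].
    by rewrite !big_nil morph_group1.
  rewrite !big_cons phiM IH; congr (_ * _)%g.
  by rewrite /c' !commgEl !conjgE !phiM !(morph_groupV phiM).
rewrite phi_bd subrr sub0r => /filN; rewrite opprK.
suff -> : \sum_(i < g) dl i = ev (\sum_a bracket (tgen a) (t a)) by [].
exact: tens_eval_boundary.
Qed.

Context (G' : groupType) (p : G -> G') (phi' : G' -> G').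
Hypothesis pM : {morph p : x y / (x * y)%g}.
Hypothesis p_meridian : forall i, p (b (inl i)) = 1%g.
Hypothesis p_parallel : free_basis (fun i => p (b (inr i))).
Hypothesis phi'M : {morph phi' : x y / (x * y)%g}.
Hypothesis p_phi : forall x, p (phi x) = phi' (p x).

(** Pulling back along [p] realises H -> H' on tensors: by [tens_eval_map], evaluation at these
    generator values is [tens_map] along [hproj] followed by evaluation at [n]. *)
Lemma rep_pull_gen (A : nzRingType) (F : filtration A)
    (rho : representation G' F) (n : 'I_g -> A) :
  (forall i, rho (p (b (inr i))) = 1 + n i) ->
  forall a, rep_pull pM rho (b a) = 1 + (tens_eval n \o @hproj g) a.
Proof.
move=> rho_gen [i|i] /=; first by rewrite p_meridian rep1 raddf0 addr0.
by rewrite rho_gen tens_eval_gen.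
Qed.

Lemma homogeneous_hproj a : homogeneous 1 (@hproj g a).
Proof. by case: a => i; [exact: homogeneous0|exact: homogeneous_gen]. Qed.

(** As [p] intertwines [phi] and [phi'] and kills meridians, it kills the Johnson quotient of a
    meridian; the leading term in representations pulled back from [G'] is therefore zero. *)
Lemma johnson_meridian_proj i : tens_map (@hproj g) (t (inr i)) = 0.
Proof.
apply: (@homogeneous_eq0 _ k.+1) => [|w wk].
  by apply: homogeneous_map => [a|]; [exact: homogeneous_hproj|exact: homogeneous_free_lie].
have [rho rho_gen] := free_word_rep w p_parallel.
have [_] := rep_johnson (rep_pull_gen rho_gen) (inl i).
rewrite hom_of_meridian raddfN opprK /= pM p_phi p_meridian (morph_group1 phi'M) mul1g.
by rewrite (morph_groupV pM) p_meridian invg1 rep1 subrr add0r tens_eval_map.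
Qed.

End JohnsonImage.

(** * Laurent polynomials and Fox calculus *)

Section Laurent.
Context (K : fieldType) (iota : {rmorphism {poly int} -> K}).
Hypothesis iota_inj : injective iota.
Local Notation "p %:F" := (iota p).

Definition laurent_gen : K := ('X)%:F.
Local Notation T := laurent_gen.

Lemma laurent_gen_neq0 : T != 0.
Proof. by rewrite /laurent_gen -(rmorph0 iota) (inj_eq iota_inj) polyX_eq0. Qed.

(* The (T - 1)-adic filtration of the subring Z[T, 1/T] of K. *)
Definition laurent_fil (k : nat) (x : K) : Prop :=
  exists c : nat, exists p : {poly int}, x * T ^+ c = (('X - 1) ^+ k * p)%:F.

Lemma laurent_fil0 k : laurent_fil k 0.
Proof. by exists 0%N, 0; rewrite mul0r mulr0 rmorph0. Qed.

Lemma laurent_filB k x y : laurent_fil k x -> laurent_fil k y -> laurent_fil k (x - y).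
Proof.
move=> [c [p hp]] [d [q hq]]; exists (c + d)%N, (p * 'X^d - q * 'X^c).
rewrite mulrBl exprD mulrA hp [T ^+ c * _]mulrC mulrA hq -!rmorphXn -!rmorphM -rmorphB.
by rewrite mulrBr !mulrA.
Qed.

Lemma laurent_filM k l x y :
  laurent_fil k x -> laurent_fil l y -> laurent_fil (k + l) (x * y).
Proof.
move=> [c [p hp]] [d [q hq]]; exists (c + d)%N, (p * q).
by rewrite exprD mulrACA hp hq -rmorphM mulrACA exprD.
Qed.

Lemma laurent_fil_le l k x : (k <= l)%N -> laurent_fil l x -> laurent_fil k x.
Proof.
move=> kl [c [p hp]]; exists c, (('X - 1) ^+ (l - k) * p).
by rewrite hp mulrA -exprD subnKC.
Qed.

Lemma laurent_fil1 : laurent_fil 0 1.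
Proof. by exists 0%N, 1; rewrite !mulr1 rmorph1. Qed.

Definition laurent_filtration : filtration K :=
  Filtration laurent_fil0 laurent_filB laurent_filM laurent_fil_le laurent_fil1.

Lemma laurent_fil_gen : laurent_fil 1 (T - 1).
Proof. by exists 0%N, 1; rewrite expr1 !mulr1 rmorphB rmorph1. Qed.

Lemma laurent_fil_X n : laurent_fil 0 (T ^+ n).
Proof. by exists 0%N, ('X^n); rewrite mul1r mulr1 rmorphXn. Qed.

Lemma laurent_fil_X1 n : laurent_fil 1 (T ^+ n - 1).
Proof.
rewrite subrX1; apply: (filM_le (F := laurent_filtration) (k := 1) (l := 0)) => //.
  exact: laurent_fil_gen.
by apply: (fil_sum (F := laurent_filtration)) => i _; exact: laurent_fil_X.
Qed.

(** Divide by T - 1: the quotient 1 + T + ... + T^(n-1) has n terms, each congruent to 1. *)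
Lemma laurent_fil_X2 n : laurent_fil 2 (T ^+ n - 1 - (T - 1) * n%:R).
Proof.
rewrite subrX1 -mulrBr.
apply: (filM_le (F := laurent_filtration) (k := 1) (l := 1)) => //.
  exact: laurent_fil_gen.
rewrite -[n in n%:R]card_ord -sumr_const -sumrB.
by apply: (fil_sum (F := laurent_filtration)) => i _; exact: laurent_fil_X1.
Qed.

Lemma laurent_fil_Vgen n : laurent_fil 0 (T ^- n).
Proof.
exists n, 1; rewrite mulVf ?expf_neq0 ?laurent_gen_neq0//.
by rewrite mulr1 rmorph1.
Qed.

(** If n > 0, then 0 is a root of [p] or of [q], and one factor X cancels; if n = 0, additivity of
    degrees makes [p] constant. *)
Lemma poly_mul_eqX (p q : {poly int}) n : p * q = 'X^n ->
  exists (s : int) (a : nat), p = s *: 'X^a.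
Proof.
elim: n p q => [|n IH] p q.
  rewrite expr0 => pq; exists p`_0, 0%N.
  rewrite expr0 alg_polyC; apply: size1_polyC.
  have [p0 q0] : p != 0 /\ q != 0.
    by split; apply/eqP => e; move/eqP: pq; rewrite e ?mul0r ?mulr0 eq_sym oner_eq0.
  have := size_mul p0 q0; rewrite pq size_poly1.
  move: p0 q0; rewrite -!size_poly_gt0.
  case: (size p) => // a; case: (size q) => // c; rewrite addSn addnS /=.
  by move=> _ _ [] /esym/eqP; rewrite addn_eq0 => /andP[/eqP -> _].
move=> pq; have : (p * q).[0] = 0 by rewrite pq hornerXn expr0n.
rewrite hornerM => /eqP; rewrite mulf_eq0 => /orP[] /eqP/rootP/factor_theorem[r].
  rewrite subr0 => e; have /IH[s [a ra]] : r * q = 'X^n.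
    by apply: (mulIf (negbT (polyX_eq0 int))); rewrite -exprSr -pq e mulrAC.
  by exists s, a.+1; rewrite e ra -scalerAl exprSr.
rewrite subr0 => e; apply: (IH p r).
by apply: (mulIf (negbT (polyX_eq0 int))); rewrite -exprSr -pq e mulrA.
Qed.

(* A unit of Z[T, 1/T] is a monomial up to sign; the one given here is 1 to
   second order at T = 1, hence is 1. *)
Lemma laurent_unit_coef (x y : K) (c : int) k : (1 < k)%N ->
  laurent_fil 0 x -> laurent_fil 0 y -> x * y = 1 ->
  laurent_fil k.+1 (x - 1 - (T - 1) ^+ k * c%:~R) -> c = 0.
Proof.
move=> k2 [d [p hp]] [d' [q hq]] xy [e [r hr]].
rewrite !expr0 !mul1r in hp hq.
have [s [a pE]] : exists (s : int) (a : nat), p = s *: 'X^a.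
  apply: (@poly_mul_eqX p q (d + d')); apply: iota_inj; rewrite rmorphM -hp -hq.
  by rewrite mulrACA xy mul1r -exprD rmorphXn.
have E : p * 'X^e - 'X^(d + e) - ('X - 1) ^+ k * c%:P * 'X^(d + e) =
    ('X - 1) ^+ k.+1 * r * 'X^d.
  apply: iota_inj.
  rewrite [RHS]rmorphM -hr !rmorphB !rmorphM -hp !rmorphXn !rmorphB rmorph1 -/T.
  have -> : c%:P%:F = c%:~R by rewrite -[c in c%:P]intz rmorph_int /= rmorph_int.
  rewrite exprD; ring.
(* [r'] gathers everything multiplied by (X - 1)^k after clearing denominators; its value at 1 is
   the coefficient [c]. *)
pose r' := c%:P * 'X^(d + e) + ('X - 1) * r * 'X^d.
have r1 : r'.[1] = c.
  by rewrite /r' !(hornerD, hornerM, hornerC, hornerXn, hornerN, hornerX) !expr1n; ring.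
have {}E : s *: 'X^(a + e) = 'X^(d + e) + ('X - 1) ^+ k * r'.
  rewrite /r' exprD scalerAl -pE; move: E; rewrite exprSr => E.
  by rewrite mulrDr !mulrA -E; ring.
clearbody r'; case: k k2 E {hr} => [|[|k]]// _ E.
have X1 : ('X - 1 : {poly int}).[1] = 0 by rewrite hornerD hornerN hornerX hornerC subrr.
have at1 : s = 1.
  have := congr1 (fun z => z.[1]) E.
  rewrite hornerD hornerM hornerZ !hornerXn !expr1n horner_exp X1 exprS !mul0r.
  by rewrite addr0 mulr1.
(* As k >= 2, the term with (X - 1)^k has zero derivative at 1, so the derivatives there compare the
   exponents. Then (X - 1)^k r' = 0, which gives r' = 0. *)
have ade : (a + e = d + e)%N.
  have := congr1 (fun z => z^`().[1]) E.
  have -> : (('X^(d + e) + ('X - 1) ^+ k.+2 * r')^`()).[1] = (d + e)%:R.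
    rewrite derivD hornerD derivXn hornerMn hornerXn expr1n exprS -mulrA derivM hornerD.
    by rewrite !hornerM horner_exp X1 exprS !(mul0r, mulr0) !addr0.
  rewrite at1 scale1r derivXn hornerMn hornerXn expr1n.
  by move/eqP; rewrite eqr_nat => /eqP.
move: E; rewrite at1 scale1r ade => /eqP.
rewrite -subr_eq0 opprD addrA subrr sub0r oppr_eq0 mulf_eq0 expf_eq0 /= polyXsubC_eq0.
by move=> /eqP r0; rewrite -r1 r0 horner0.
Qed.

End Laurent.

(** * Determinants close to 1 *)

Section FilteredDeterminant.
Context (A : comNzRingType) (F : filtration A).

Lemma fil0M x y : F 0 x -> F 0 y -> F 0 (x * y).
Proof. exact: filM. Qed.

Lemma fil0_prod (I : Type) (r : seq I) (P : pred I) (E : I -> A) :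
  (forall i, P i -> F 0 (E i)) -> F 0 (\prod_(i <- r | P i) E i).
Proof. by move=> h; apply: (big_ind (F 0)) => //; [exact: fil1|exact: fil0M]. Qed.

Lemma fil0_sign (c : bool) : F 0 ((-1) ^+ c : A).
Proof. by case: c; rewrite ?expr1 ?expr0; [apply/filN/fil1|exact: fil1]. Qed.

Lemma fil_det n (M : 'M[A]_n) : (forall i j, F 0 (M i j)) -> F 0 (\det M).
Proof.
move=> h; apply: fil_sum => s _; apply: fil0M; first exact: fil0_sign.
exact: fil0_prod.
Qed.

Lemma fil_prod_1D k (I : Type) (r : seq I) (E : I -> A) : (0 < k)%N ->
  (forall i, F k (E i)) ->
  F k.+1 (\prod_(i <- r) (1 + E i) - 1 - \sum_(i <- r) E i).
Proof.
move=> k0 h; elim: r => [|i r IH].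
  by rewrite !big_nil subrr subr0; exact: fil0.
rewrite !big_cons; set P := \prod_(j <- r) _; set S := \sum_(j <- r) _.
have hS : F k S by exact: fil_sum.
have hP : F k (P - 1) by apply: fil_congr hS; apply: fil_le IH.
have -> : (1 + E i) * P - 1 - (E i + S) = (P - 1 - S) + E i * (P - 1) by ring.
apply: filD => //; apply: filM_le (h i) hP; lia.
Qed.

(** The identity permutation contributes 1 plus the trace. Any other permutation moves some [i] and
    then also its image, so its term contains two entries of degree k, and 2k >= k+1. *)
Lemma fil_det_1D n k (E : 'M[A]_n) : (0 < k)%N -> (forall i j, F k (E i j)) ->
  F k.+1 (\det (1%:M + E) - 1 - \tr E).
Proof.
move=> k0 hE; rewrite /determinant (bigD1 (1%g : 'S_n))//= odd_perm1 expr0 mul1r.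
set D := (X in _ + X - 1 - _).
have -> : \prod_i (1%:M + E) i ((1%g : 'S_n) i) = \prod_i (1 + E i i).
  by apply: eq_bigr => i _; rewrite perm1 !mxE eqxx.
have hD : F k.+1 D.
  apply: fil_sum => s s1.
  have [i si] : exists i, s i != i.
    apply/existsP; apply: contraNT s1; rewrite negb_exists => /forallP h.
    by apply/eqP/permP => i; rewrite perm1; apply/eqP; rewrite -[_ == _]negbK h.
  have h0 a : F 0 ((1%:M + E) a (s a)).
    rewrite !mxE; apply: filD; last by apply: fil_le (hE _ _).
    by case: (_ == _); [exact: fil1|exact: fil0].
  have hk a : s a != a -> F k ((1%:M + E) a (s a)).
    by move=> sa; rewrite !mxE eq_sym (negPf sa) add0r.
  have ssi : s (s i) != s i by rewrite (inj_eq perm_inj).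
  rewrite -[k.+1]add0n; apply: filM; first exact: fil0_sign.
  rewrite (bigD1 i)//= (bigD1 (s i))//= -[k.+1]addn0 mulrA.
  apply: filM; last exact: fil0_prod.
  by apply: filM_le (hk _ si) (hk _ ssi); lia.
rewrite (addrAC _ D) (addrAC _ D); apply: filD => //.
exact: fil_prod_1D.
Qed.

End FilteredDeterminant.

(** A multiplicative map to a commutative ring sends commutators to 1, and beyond the first term the
    lower central series is generated by commutators. *)
Lemma commutative_lcs (G : groupType) (A : comNzRingType) (chi : G -> A) k x :
  chi 1%g = 1 -> (forall x y, chi (x * y)%g = chi x * chi y) ->
  (1 < k)%N -> lcs k x -> chi x = 1.
Proof.
move=> chi1 chiM; case: k => [|[|k]]// _.
have chiV z : chi z^-1%g * chi z = 1 by rewrite -chiM mulVg.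
rewrite /lcs /=; elim=> {x} [_ [x _ [y _ <-]]||x y _ hx _ hy|x _ hx].
- by rewrite commgEl conjgE !chiM (mulrCA (chi y^-1%g)) chiV mulr1 chiV.
- exact: chi1.
- by rewrite chiM hx hy mulr1.
- by rewrite -[LHS]mulr1 -hx chiV.
Qed.

(** * Affine two-by-two matrices *)

Section ColumnFiltration.
Context (A : nzRingType) (F : filtration A).

(** The conditions on the first column force a matrix congruent to 1 in degree 1 to have first
    column (1, 0), that is, to be of the form [affine_mx]. *)
Definition col_fil (k : nat) (M : 'M[A]_2) : Prop :=
  [/\ mx_fil F k M, M 1 0 = 0 & (0 < k)%N -> M 0 0 = 0].

Lemma mx2E (M N : 'M[A]_2) i j : (M * N) i j = M i 0 * N 0 j + M i 1 * N 1 j.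
Proof.
by rewrite mxE !big_ord_recl big_ord0 addr0; congr (_ + M _ _ * N _ _); apply: val_inj.
Qed.

Lemma col_filM k l M N : col_fil k M -> col_fil l N -> col_fil (k + l) (M * N).
Proof.
move=> [hM M10 M00] [hN N10 N00]; split; first exact: mx_filM.
- by rewrite mx2E M10 N10 mul0r mulr0 addr0.
- rewrite addn_gt0 mx2E N10 mulr0 addr0 => /orP[/M00->|/N00->].
  + by rewrite mul0r.
  + by rewrite mulr0.
Qed.

Definition col_filtration : filtration 'M[A]_2.
Proof.
apply: (@Filtration _ col_fil).
- by move=> k; split=> [|| _]; [exact: mx_fil0| |]; rewrite mxE.
- move=> k M N [hM M10 M00] [hN N10 N00]; split; first exact: mx_filB.
  + by rewrite !mxE M10 N10 subr0.
  + by move=> k0; rewrite !mxE M00// N00// subr0.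
- exact: col_filM.
- move=> l k M kl [hM M10 M00]; split=> // [|k0]; first exact: mx_fil_le hM.
  by apply: M00; exact: leq_trans kl.
- by split=> //; [exact: mx_fil1|rewrite mxE].
Defined.

End ColumnFiltration.

Lemma ord2P (a : 'I_2) : a = 0 \/ a = 1.
Proof. by case: a => [[|[|//]] ?]; [left|right]; exact: val_inj. Qed.

Lemma mx2P (A : Type) (M N : 'M[A]_2) :
  M 0 0 = N 0 0 -> M 0 1 = N 0 1 -> M 1 0 = N 1 0 -> M 1 1 = N 1 1 -> M = N.
Proof.
by move=> h00 h01 h10 h11; apply/matrixP => a c;
   case: (ord2P a) => ->; case: (ord2P c) => ->.
Qed.

Section Affine.
Context (A : nzRingType).

Definition affine_mx (x y : A) : 'M[A]_2 :=
  \matrix_(a, c) if c == 0 then (a == 0)%:R else if a == 0 then x else y.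

(** The upper entry obeys a Leibniz rule twisted on the right by the lower one. A representation by
    such matrices is thus a character together with a Fox derivation. *)
Lemma affine_mxM x y x' y' :
  affine_mx x y * affine_mx x' y' = affine_mx (x' + x * y') (y * y').
Proof. by apply: mx2P; rewrite mx2E !mxE /= ?(mul1r, mul0r, mulr0, mulr1, addr0, add0r). Qed.

Lemma affine_mx1 : affine_mx 0 1 = 1.
Proof. by apply: mx2P; rewrite !mxE. Qed.

Lemma affine_mx01 x y : affine_mx x y 0 1 = x. Proof. by rewrite mxE. Qed.

Lemma affine_mx11 x y : affine_mx x y 1 1 = y. Proof. by rewrite mxE. Qed.

Lemma affine_mx_fil (F : filtration A) x y :
  F 0 x -> F 1 (y - 1) -> col_filtration F 1 (affine_mx x y - 1).
Proof.
move=> hx hy; split; last by rewrite !mxE subrr.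
- move=> a c; case: (ord2P a) => ->; case: (ord2P c) => ->; rewrite !mxE /=.
  + by rewrite subrr; exact: fil0.
  + by rewrite subr0.
  + by rewrite subr0; exact: fil0.
  + exact: hy.
- by rewrite !mxE subr0.
Qed.

Lemma rep_affine (G : groupType) (F : filtration A)
    (rho : representation G (col_filtration F)) x :
  rho x = affine_mx (rho x 0 1) (rho x 1 1).
Proof.
have [_ h10 /(_ isT) h00] := rep_fil rho x.
move: h10 h00; rewrite !mxE /= => /eqP; rewrite subr0 => /eqP h10 /eqP.
by rewrite subr_eq0 => /eqP h00; apply: mx2P; rewrite mxE.
Qed.

End Affine.

(** * Fox derivatives with values in Laurent polynomials *)

Section FoxRepresentation.
Context (K : fieldType) (iota : {rmorphism {poly int} -> K}).
Hypothesis iota_inj : injective iota.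
Local Notation F := (laurent_filtration iota).
Local Notation T := (laurent_gen iota).
Context (g : nat) (v : 'I_g -> nat).

(** Subtracting 1 gives the shape [1 + n] of [free_basis_rep]. In the resulting representation,
    entry (1,1) is the character with values T^(v_j) on the basis, and entry (0,1) is the Fox
    derivative in the i-th basis element. *)
Definition fox_mx (i j : 'I_g) : 'M[K]_2 := affine_mx (i == j)%:R (T ^+ v j) - 1.

Lemma fox_rep (G : groupType) (c : 'I_g -> G) : free_basis c ->
  exists rho : 'I_g -> representation G (col_filtration F),
    forall i j, rho i (c j) = 1 + fox_mx i j.
Proof.
move=> cfree.
(* By [affine_mxM], the inverse of [affine_mx x y] is [affine_mx (- x / y) y^-1]. *)
pose inv i j : 'M[K]_2 := affine_mx (- (i == j)%:R * T ^- v j) (T ^- v j) - 1.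
have Tn0 j : T ^+ v j != 0 by rewrite expf_neq0// laurent_gen_neq0.
have hT j : F 1 (T ^- v j - 1).
  have -> : T ^- v j - 1 = - (T ^- v j * (T ^+ v j - 1)).
    by rewrite mulrBr mulVf// mulr1 opprB.
  apply: filN; apply: (filM (k := 0) (l := 1)); first exact: laurent_fil_Vgen.
  exact: laurent_fil_X1.
have hd i j : F 0 ((i == j)%:R : K) by case: (_ == _); [exact: fil1|exact: fil0].
have h i : exists rho : representation G (col_filtration F),
    forall j, rho (c j) = 1 + fox_mx i j.
  apply: (@free_basis_rep _ _ _ _ c (fox_mx i) (inv i)) => // j.
  - rewrite /fox_mx /inv !(addrC 1) !subrK affine_mxM mulfV// mulNr addNr.
    exact: affine_mx1.
  - rewrite /fox_mx /inv !(addrC 1) !subrK affine_mxM mulVf// !mulNr mulfVK// subrr.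
    exact: affine_mx1.
  - by apply: affine_mx_fil => //; exact: laurent_fil_X1.
  - apply: affine_mx_fil => //.
    by apply: (filM (k := 0) (l := 0)); [exact: filN|exact: laurent_fil_Vgen].
exists (fun i => sval (cid (h i))) => i j; exact: (svalP (cid (h i))).
Qed.

Lemma fox_mx_col0 i j a : fox_mx i j a 0 = 0.
Proof. by case: (ord2P a) => ->; rewrite !mxE ?subrr. Qed.

Lemma word_fox11 i (s : seq 'I_g) :
  (\prod_(j <- s) fox_mx i j) 1 1 = \prod_(j <- s) (T ^+ v j - 1).
Proof.
elim: s => [|j s IH]; first by rewrite !big_nil mxE.
by rewrite !big_cons mx2E fox_mx_col0 mul0r add0r IH !mxE.
Qed.

(** As the first column of [fox_mx] is zero, only the first letter is tested against [i] and the
    others contribute scalars: this is the contraction of the first tensor factor. *)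
Lemma word_fox01 i j (s : seq 'I_g) :
  (\prod_(l <- j :: s) fox_mx i l) 0 1 = (i == j)%:R * \prod_(l <- s) (T ^+ v l - 1).
Proof. by rewrite big_cons mx2E fox_mx_col0 mul0r add0r word_fox11 !mxE subr0. Qed.

Lemma laurent_fil_prod (s : seq 'I_g) :
  F (size s).+1 (\prod_(l <- s) (T ^+ v l - 1) - (T - 1) ^+ size s * (\prod_(l <- s) v l)%:R).
Proof.
elim: s => [|j s IH].
  by rewrite !big_nil mulr1 subrr; exact: fil0.
rewrite !big_cons natrM exprS mulrACA.
apply: (fil_congrM (k := 2) (l := size s) (m := 1) _ _ _ (p := (size s).+1)) => //.
- exact: laurent_fil_X2.
- apply: fil_congr (fil_le (leqnSn _) IH) _.
  rewrite mulrC pmulrn; apply: fil_int.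
  by have := filX (size s) (laurent_fil_gen iota : F 1 _); rewrite mul1n.
- rewrite mulrC pmulrn; apply: fil_int; exact: laurent_fil_gen.
Qed.

Definition weight_eval (q : mpoly g int) : int := meval (fun i => (v i)%:R) q.

Lemma symmE (u : tens 'I_g) :
  symm u = tens_eval (fun j => mpolyX int (mnm1 j) : mpoly g int) u.
Proof. by []. Qed.

Lemma weight_eval_word (w : fmonom 'I_g) :
  weight_eval (symm (mkmalgU w 1)) = (\prod_(l <- (w : seq _)) v l)%:R.
Proof.
rewrite symmE /tens_eval mmapU mul1r /word_eval /weight_eval rmorph_prod natr_prod.
by apply: eq_bigr => l _; rewrite /= mevalXU.
Qed.

Definition contract_weight i (w : seq 'I_g) : int :=
  if w is j :: s then (i == j)%:R * (\prod_(l <- s) v l)%:R else 0.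

Lemma weight_eval_contract i (u : tens 'I_g) :
  weight_eval (symm (Defs.contract i u)) =
  \sum_(w <- msupp u) mcoeff w u * contract_weight i w.
Proof.
pose h (w : fmonom 'I_g) := if (w : seq 'I_g) is j :: w' then
  mkmalgU (FMonom w') (@omega g (inl i) (inr j)) else 0 : tens 'I_g.
have -> : Defs.contract i u = \sum_(w <- msupp u) (mcoeff w u)%:~R * h w by [].
have -> : symm (\sum_(w <- msupp u) (mcoeff w u)%:~R * h w) =
    \sum_(w <- msupp u) symm ((mcoeff w u)%:~R * h w) by exact: raddf_sum.
have -> : weight_eval (\sum_(w <- msupp u) symm ((mcoeff w u)%:~R * h w)) =
    \sum_(w <- msupp u) weight_eval (symm ((mcoeff w u)%:~R * h w)) by exact: raddf_sum.
apply: eq_bigr => w _; rewrite mulrzl.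
have -> : weight_eval (symm (h w *~ mcoeff w u)) = weight_eval (symm (h w)) *~ mcoeff w u.
  by rewrite !symmE /weight_eval !raddfMz.
rewrite mulrC -mulrzr intz; congr (_ * _); rewrite /h /contract_weight.
case: (w : seq 'I_g) => [|j s] /=; first by rewrite symmE /weight_eval !raddf0.
case: (i == j); last by rewrite mul0r monalgU0 symmE /weight_eval !raddf0.
by rewrite mul1r weight_eval_word.
Qed.

(** To first order T^(v_l) - 1 is v_l (T - 1). A word j s thus contributes its contraction,
    evaluated at [v], times (T - 1)^k, and commutativity of [K] accounts for the passage to the
    symmetric power. *)
Lemma fox_contract i k (u : tens 'I_g) : homogeneous k.+1 u ->
  F k.+1 (tens_eval (fox_mx i) u 0 1 -
          (T - 1) ^+ k * (weight_eval (symm (Defs.contract i u)))%:~R).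
Proof.
move=> hu; rewrite tens_evalE summxE weight_eval_contract.
have -> : (T - 1) ^+ k * (\sum_(w <- msupp u) mcoeff w u * contract_weight i w)%:~R =
    \sum_(w <- msupp u) (mcoeff w u)%:~R * ((T - 1) ^+ k * (contract_weight i w)%:~R).
  rewrite -[X in _ * X]/(intr _) rmorph_sum mulr_sumr.
  by apply: eq_bigr => w _; rewrite rmorphM mulrCA.
rewrite -sumrB big_seq; apply: fil_sum => w /(homogeneous_size hu).
have -> : ((mcoeff w u)%:~R * word_eval (fox_mx i) w : 'M[K]_2) 0 1 =
    (mcoeff w u)%:~R * word_eval (fox_mx i) w 0 1 by rewrite mulrzl -scaler_int mxE.
rewrite /contract_weight /word_eval -mulrBr.
case: (w : seq 'I_g) => [//|j s] /= [<-]; apply: (fil_int (F := F)).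
rewrite word_fox01; case: (i == j); last by rewrite !mul0r mulr0 subr0; exact: fil0.
by rewrite !mul1r natz -pmulrn; exact: laurent_fil_prod.
Qed.

End FoxRepresentation.

(** * The Lagrangian trace and the Fox Jacobian *)

Section LagrangianTrace.
Context (g k : nat) (G : groupType) (b : hidx g -> G) (phi : G -> G).
Context (t : hidx g -> tens (hidx g)).
Hypothesis k_gt1 : (1 < k)%N.
Hypothesis t_lie : forall a, free_lie k.+1 (t a).
Hypothesis t_class : forall x u, lcs_class b 1 x u ->
  lcs_class b k.+1 (phi x * x^-1)%g (hom_of t u).
Hypothesis phi_johnson : forall x, lcs k.+1 (phi x * x^-1)%g.

Context (G' : groupType) (p : G -> G') (phi' : G' -> G').
Hypothesis pM : {morph p : x y / (x * y)%g}.
Hypothesis p_meridian : forall i, p (b (inl i)) = 1%g.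
Let c i := p (b (inr i)).
Hypothesis p_parallel : free_basis c.
Hypothesis phi'M : {morph phi' : x y / (x * y)%g}.
Hypothesis phi'_surj : forall y, exists x, phi' x = y.
Hypothesis p_phi : forall x, p (phi x) = phi' (p x).

Section FoxMatrix.
Context (K : fieldType) (iota : {rmorphism {poly int} -> K}).
Hypothesis iota_inj : injective iota.
Local Notation F := (laurent_filtration iota).
Local Notation T := (laurent_gen iota).
Context (v : 'I_g -> nat).
Context (rho : 'I_g -> representation G' (col_filtration F)).
Hypothesis rho_gen : forall i j, rho i (c j) = 1 + fox_mx iota v i j.

Let D i x : K := rho i x 0 1.
Let chi i x : K := rho i x 1 1.

Lemma chiM i x y : chi i (x * y)%g = chi i x * chi i y.
Proof. by rewrite /chi repM (rep_affine _ x) (rep_affine _ y) affine_mxM !affine_mx11. Qed.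

Lemma chi1 i : chi i 1%g = 1.
Proof. by rewrite /chi rep1 mxE. Qed.

Lemma foxM i x y : D i (x * y)%g = D i y + D i x * chi i y.
Proof.
rewrite /D /chi repM (rep_affine _ x) (rep_affine _ y) affine_mxM.
by rewrite !affine_mx01 affine_mx11.
Qed.

Lemma fox1 i : D i 1%g = 0.
Proof. by rewrite /D rep1 mxE. Qed.

Lemma rho_genE i j : rho i (c j) = affine_mx (i == j)%:R (T ^+ v j).
Proof. by rewrite rho_gen /fox_mx addrC subrK. Qed.

Lemma fox_gen i j : D i (c j) = (i == j)%:R.
Proof. by rewrite /D rho_genE affine_mx01. Qed.

Lemma chi_gen i j : chi i (c j) = T ^+ v j.
Proof. by rewrite /chi rho_genE affine_mx11. Qed.

Lemma chi_indep i j : chi i =1 chi j.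
Proof.
apply: (free_basis_uniq p_parallel (chi1 i) (chi1 j) (chiM i) (chiM j)) => l.
by rewrite !chi_gen.
Qed.

Let B i := p (phi (b (inr i)) * (b (inr i))^-1)%g.

Lemma phi'_gen i : phi' (c i) = (B i * c i)%g.
Proof. by rewrite /B /c -pM -mulgA mulVg mulg1 p_phi. Qed.

Lemma chi_B i j : chi i (B j) = 1.
Proof.
apply: (@commutative_lcs _ _ (chi i \o p) k.+1) => /=; last exact: phi_johnson.
- by rewrite (morph_group1 pM) chi1.
- by move=> x y; rewrite pM chiM.
- exact: ltnW.
Qed.

Definition fox_jacobian : 'M[K]_g := \matrix_(i, j) D j (phi' (c i)).
Local Notation M := fox_jacobian.

(** Both sides are upper entries of multiplicative families of affine matrices, so agreement on the
    basis suffices. Multiplicativity of the right side uses that the character is independent of the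
    index; the lower entries agree on the basis since [phi'] preserves the character, by [chi_B]. *)
Lemma fox_chain_rule j x : D j (phi' x) = \sum_l D l x * M l j.
Proof.
pose s y := affine_mx (\sum_l D l y * M l j) (chi j y).
suff -> : D j (phi' x) = s x 0 1 by rewrite affine_mx01.
rewrite /D; congr (fun_of_matrix _ 0 1); move: x.
apply: (free_basis_uniq p_parallel) => [||x y|x y|i].
- by rewrite (morph_group1 phi'M) rep1.
- by rewrite /s chi1 big1 ?affine_mx1// => l _; rewrite fox1 mul0r.
- by rewrite phi'M repM.
- rewrite /s affine_mxM chiM; congr affine_mx.
  rewrite mulr_suml -big_split /=; apply: eq_bigr => l _.
  by rewrite foxM mulrDl (chi_indep l j); ring.
- rewrite (rep_affine _ (phi' _)) /s -/(D _ _) -/(chi _ _); congr affine_mx.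
    rewrite (bigD1 i)//= fox_gen eqxx mul1r mxE big1 ?addr0// => l /negPf li.
    by rewrite fox_gen li mul0r.
  by rewrite phi'_gen chiM chi_B mul1r.
Qed.

Lemma fox_fil i x : F 0 (D i x).
Proof. by have [/(_ 0 1)] := rep_fil (rho i) x; rewrite !mxE subr0. Qed.

(** The rows of [N] are the Fox derivatives of preimages of the basis under [phi']; the chain rule
    gives N M = 1. Degree 0 means that the entries lie in Z[T, 1/T]. *)
Lemma fox_jacobian_unit :
  exists N : 'M[K]_g, (forall i j, F 0 (N i j)) /\ \det N * \det M = 1.
Proof.
pose y i := sval (cid (phi'_surj (c i))).
have yE i : phi' (y i) = c i by exact: svalP (cid (phi'_surj (c i))).
exists (\matrix_(i, j) D j (y i)); split=> [i j|]; first by rewrite mxE; exact: fox_fil.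
rewrite -det_mulmx -(det1 K g); congr (\det _); apply/matrixP => i j.
rewrite !mxE eq_sym -(fox_gen j i) -yE fox_chain_rule.
by apply: eq_bigr => l _; rewrite mxE.
Qed.

(** Since [phi'] sends [c i] to [B i * c i], the matrix M - 1 has degree k, and its trace has
    leading coefficient [P], the Lagrangian trace at [v]. Then det M is a unit with expansion 1 + (T
    - 1)^k P, and [laurent_unit_coef] gives P = 0. *)
Lemma lagrangian_trace_weight :
  weight_eval v (lagrangian_trace t) = 0.
Proof.
pose u i := tens_map (@hproj g) (t (inl i)).
have hu i : homogeneous k.+1 (u i).
  by apply: homogeneous_map => [a|]; [exact: homogeneous_hproj|exact: homogeneous_free_lie].
(* Entry (0,1) loses one degree in [mx_fil]: degrees k+1 and k+2 of the matrices become k and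
   k+1. *)
have hB i j : F k (tens_eval (fox_mx iota v j) (u i) 0 1) /\
    F k.+1 (D j (B i) - tens_eval (fox_mx iota v j) (u i) 0 1).
  have := rep_johnson t_class (rep_pull_gen pM p_meridian (rho_gen j)) (inr i).
  rewrite hom_of_parallel -tens_eval_map => -[[/(_ 0 1) h1 _ _] [/(_ 0 1) h2 _ _]].
  by move: h1 h2; rewrite !mxE /= !addn0 !subn1 subr0.
pose E : 'M[K]_g := M - 1%:M.
have EE i j : E i j = D j (B i) * T ^+ v i.
  by rewrite !mxE phi'_gen foxM chi_gen fox_gen eq_sym addrAC subrr add0r.
have hDB i j : F k (D j (B i)).
  by have [h1 h2] := hB i j; apply: fil_congr h1; apply: fil_le h2.
have hE i j : F k (E i j).
  by rewrite EE -[k]addn0; apply: filM; [exact: hDB|exact: laurent_fil_X].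
pose P := weight_eval v (lagrangian_trace t).
have PE : P = \sum_i weight_eval v (symm (Defs.contract i (u i))).
  by rewrite /P /lagrangian_trace /weight_eval raddf_sum.
have htr : F k.+1 (\tr E - (T - 1) ^+ k * P%:~R).
  rewrite PE /mxtrace -[X in _ * X]/(intr _) rmorph_sum mulr_sumr -sumrB.
  apply: fil_sum => i _.
  (* The factor T^(v_i) is congruent to 1, so it does not affect the leading term. *)
  apply: (@fil_trans _ _ _ (D i (B i))).
    rewrite EE -[X in _ - X]mulr1 -mulrBr -addn1.
    by apply: filM; [exact: hDB|exact: laurent_fil_X1].
  apply: (fil_trans (hB i i).2); exact: fox_contract.
have [N [hN NM]] := fox_jacobian_unit.
apply: (@laurent_unit_coef _ _ iota_inj (\det M) (\det N) _ k) => //.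
- by apply: (fil_det (F := F)) => i j; rewrite mxE; exact: fox_fil.
- exact: (fil_det (F := F)).
- by rewrite mulrC.
- apply: (fil_trans (F := F) _ htr).
  by have := fil_det_1D (ltnW k_gt1) hE; rewrite /E [1%:M + _]addrC subrK.
Qed.

End FoxMatrix.

End LagrangianTrace.

(** * Integer points and Kronecker substitution *)

Lemma base_expansion_inj (B n : nat) (a a' : 'I_n -> nat) :
  (forall i, a i < B)%N -> (forall i, a' i < B)%N ->
  (\sum_(i < n) a i * B ^ i = \sum_(i < n) a' i * B ^ i)%N -> a =1 a'.
Proof.
elim: n a a' => [|n IH] a a' ha ha' e; first by case.
have B0 : (0 < B)%N by apply: leq_ltn_trans (ha ord0).
have split_sum (c : 'I_n.+1 -> nat) : (\sum_(i < n.+1) c i * B ^ i =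
    (\sum_(i < n) c (lift ord0 i) * B ^ i) * B + c ord0)%N.
  rewrite big_ord_recl expn0 muln1 addnC big_distrl /=; congr (_ + _)%N.
  by apply: eq_bigr => i _; rewrite /= -mulnA -expnSr.
move: e; rewrite !split_sum => e.
have e0 : a ord0 = a' ord0.
  by have := congr1 (modn^~ B) e; rewrite !modnMDl !modn_small.
have /IH eS : (\sum_(i < n) a (lift ord0 i) * B ^ i =
    \sum_(i < n) a' (lift ord0 i) * B ^ i)%N.
  by move/eqP: e; rewrite e0 eqn_add2r eqn_pmul2r// => /eqP.
by move=> i; case: (unliftP ord0 i) => [j|] -> //; exact: eS.
Qed.

Lemma poly_nat_roots_eq0 (r : {poly int}) : (forall y : nat, r.[y%:R] = 0) -> r = 0.
Proof.
move=> h; apply/eqP; case: eqP => // /eqP r0.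
have := @max_poly_roots _ r [seq y%:R | y <- iota 0 (size r)] r0.
rewrite size_map size_iota ltnn; apply=> //.
- by apply/allP => _ /mapP[y _ ->]; apply/rootP.
- rewrite map_inj_uniq ?iota_uniq// => y z /eqP.
  by rewrite eqr_nat => /eqP.
Qed.

(* Kronecker substitution: X_i := y^(B^i) separates the monomials whose
   exponents are less than B. *)
Lemma weight_eval_eq0 (g : nat) (q : mpoly g int) :
  (forall v : 'I_g -> nat, weight_eval v q = 0) -> q = 0.
Proof.
(* [B] strictly exceeds the total degree of every monomial of [q], hence every exponent. *)
move=> h; pose B := mpoly.mmeasure (@mpoly.mdeg g) q.
pose code (m : multinom g) := (\sum_(i < g) m i * B ^ i)%N.
have mB m i : m \in mpoly.msupp q -> (m i < B)%N.
  move=> mq; apply: leq_ltn_trans (mpoly.msize_mdeg_lt mq).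
  by rewrite mpoly.mdegE (bigD1 i)//= leq_addr.
pose r : {poly int} := \sum_(m <- mpoly.msupp q) mpoly.mcoeff m q *: 'X^(code m).
have r0 : r = 0.
  apply: poly_nat_roots_eq0 => y; rewrite -[RHS](h (fun i => (y ^ (B ^ i))%N)).
  rewrite /r /weight_eval mevalE horner_sum; apply: eq_bigr => m _.
  rewrite hornerZ hornerXn; congr (_ * _).
  rewrite /code -natrX expn_sum natr_prod; apply: eq_bigr => i _.
  by rewrite mulnC expnM natrX.
apply/mpolyP => m; rewrite mpoly.mcoeff0.
have [mq|] := boolP (m \in mpoly.msupp q); last by move/memN_msupp_eq0.
transitivity (r`_(code m)); last by rewrite r0 coef0.
rewrite coef_sum (bigD1_seq m)//= coefZ coefXn eqxx mulr1 big_seq_cond big1 ?addr0//.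
move=> m' /andP[m'q m'm]; rewrite coefZ coefXn; case: eqP => [e|_]; last by rewrite mulr0.
case/eqP: m'm; apply/mnmP; apply: (@base_expansion_inj B) => [i|i|]; [exact: mB|exact: mB|].
by rewrite -/(code m') -/(code m).
Qed.

(** * Action on fundamental groups *)

Section HandlebodyAction.
Context (R : realType) (g : nat) (V : handlebody R g) (S : surface V).
Implicit Types f : homeo_rel S.

(** Every stage of the isotopy fixes the boundary and hence the base point, so composing it with a
    loop gives a based homotopy. *)
Lemma pi1_map_isotopic f f' : isotopic f f' ->
  pi1_map (R := R) (hr_pt f) =1 pi1_map (hr_pt f').
Proof.
move=> [h [ch h0 h1 hs]]; elim/pi1_ind => q; rewrite !pi1_mapE; apply/pi1_classP.
exists (fun st => h (st.1, q st.2)); split=> /= [|r|r|s r s01 out].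
- apply: (@comp_cont _ _ _ (fun st : R * R => (st.1, q st.2)) h) => //.
  apply: pair_cont => [st|]; first exact: cvg_fst.
  by apply: (@comp_cont _ _ _ snd q) => [st|]; [exact: cvg_snd|exact: loop_cont].
- by rewrite h0.
- by rewrite h1.
- have [psi ->] := hs s s01; rewrite loop_out//; exact: hr_fix (sf_base_boundary S).
Qed.

Lemma pi1_map_rim f : pi1_map (hr_pt f) (pi1_class (sf_rim S)) = pi1_class (sf_rim S).
Proof.
rewrite pi1_mapE; congr pi1_class; apply: loopP => r /=; apply: hr_fix.
have [out|] := boolP ((r <= 0) || (1 <= r)).
  by rewrite loop_out//; exact: sf_base_boundary.
rewrite negb_or -!ltNge => /andP[r0 r1]; rewrite /sf_boundary -sf_rim_range.
by exists r => //=; rewrite !ltW.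
Qed.

(** The extension agrees with [f] on the surface, so it fixes the base point and intertwines the
    actions; its inverse fixes the base point too and supplies preimages. *)
Lemma extension_pi1 f : extends_to_handlebody f ->
  exists phi : pi1 R (sf_incl (sf_base S)) -> pi1 R (sf_incl (sf_base S)),
    [/\ {morph phi : x y / (x * y)%g}, forall y, exists x, phi x = y &
        forall x, pi1_map (sf_ptincl S) (pi1_map (hr_pt f) x) =
                  phi (pi1_map (sf_ptincl S) x)].
Proof.
move=> [E [E' [cE cE' EK E'K Ef]]].
have Eb : E (sf_incl (sf_base S)) = sf_incl (sf_base S).
  by rewrite Ef (hr_fix f (sf_base_boundary S)).
have E'b : E' (sf_incl (sf_base S)) = sf_incl (sf_base S) by rewrite -{1}Eb EK.
exists (pi1_map (PtMap cE Eb)); split; first exact: pi1_mapM.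
- elim/pi1_ind => q; exists (pi1_map (PtMap cE' E'b) (pi1_class q)).
  by rewrite !pi1_mapE; congr pi1_class; apply: loopP => r /=; rewrite E'K.
- elim/pi1_ind => q; rewrite !pi1_mapE; congr pi1_class.
  by apply: loopP => r /=; rewrite Ef.
Qed.

End HandlebodyAction.

Theorem theoremA (R : realType) (g k : nat) (hg : (2 <= g)%N) (hk : (2 <= k)%N)
    (V : handlebody R g) (S : surface V) (m : marking S) (f : homeo_rel S)
    (hf : in_handlebody_group f) (hJ : in_johnson k f)
    (t : hidx g -> tens (hidx g)) (ht : johnson m k f t) :
  in_G k t /\ lagrangian_trace t = 0%R.
Proof.
have [t_lie t_class] := ht.
have [f' ff' /extension_pi1[phi' [phi'M phi'_surj p_phi']]] := hf.
have p_phi x : pi1_map (sf_ptincl S) (pi1_map (hr_pt f) x) =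
    phi' (pi1_map (sf_ptincl S) x) by rewrite (pi1_map_isotopic ff').
split; first split; first split=> //.
- apply: (johnson_bracket_eq0 (pi1_mapM (hr_pt f)) t_lie t_class) (ltnW hk) (mk_free m) _.
  by rewrite -mk_rim; exact: pi1_map_rim.
- move=> i; exact: (johnson_meridian_proj t_lie t_class (pi1_mapM (sf_ptincl S))
    (@mk_meridian _ _ _ _ m) (@mk_parallel _ _ _ _ m) phi'M p_phi).
- apply: weight_eval_eq0 => v.
  (* The fraction field makes T invertible while keeping Z[T] embedded, as the Laurent filtration
     requires. *)
  pose iota : {rmorphism {poly int} -> {fraction {poly int}}} := @tofrac _.
  have iota_inj : injective iota by move=> x y /eqP; rewrite tofrac_eq => /eqP.
  have [rho rho_gen] := fox_rep iota_inj v (@mk_parallel _ _ _ _ m).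
  exact: (lagrangian_trace_weight hk t_lie t_class hJ (pi1_mapM (sf_ptincl S))
    (@mk_meridian _ _ _ _ m) (@mk_parallel _ _ _ _ m) phi'M phi'_surj p_phi iota_inj rho_gen).
Qed.
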